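(* Let $(X,T)$ be a topological dynamical system and $\mu\in M(X,T)$. Then for $\mu$-a.e. $x\in X$ one has $$a_\mu(x)=\frac{1}{h_\mu(T,x)},$$ where $a_\mu(x)$ is the $\mu$-restricted asymptotic rate at $x$ and $h_\mu(T,x)$ is the Brin-Katok local entropy at $x$ with respect to $\mu$. If in addition $\mu$ is ergodic, then $T$ is $\mu$-restricted sensitive if and only if $h_\mu(T)>0$, where $h_\mu(T)$ is the measure-theoretic entropy of $T$ with respect to $\mu$.
   Context: A topological dynamical system $(X,T)$ is a compact metric space $X$ with metric $\rho$ together with a continuous map $T:X\to X$. $M(X,T)$ is the set of $T$-invariant Borel probability measures on $X$. Let $\mathscr{B}_X$ be the Borel $\sigma$-algebra of $X$ and $\mathscr{B}_\mu^+=\{V\in\mathscr{B}_X:\mu(V)>0\}$. Bowen metric and balls: $\rho_n(x,y)=\max_{0\le i\le n}\rho(T^ix,T^iy)$ and $B_n(x,\epsilon)=\{y\in X:\rho_n(x,y)<\epsilon\}$. Local entropy: by the Brin-Katok theorem, for $\mu$-a.e. $x\in X$, $$\lim_{\epsilon\to0}\liminf_{n\to\infty}\frac{-\log\mu(B_n(x,\epsilon))}{n}=\lim_{\epsilon\to0}\limsup_{n\to\infty}\frac{-\log\mu(B_n(x,\epsilon))}{n},$$ and the common value (in $[0,+\infty]$) is the local entropy $h_\mu(T,x)$. Restricted sensitivity: for $x\in X$ and $\delta>0$, $T$ is $\mu$-restricted sensitive at $x$ w.r.t. $\delta$ if there exists a real number $a>0$ such that for every $V\in\mathscr{B}_\mu^+$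 there is a nonnegative integer $n\le -a\log\mu(V)$ with $\mu(\{y\in V:\rho(T^nx,T^ny)>\delta\})>0$. Such an $a$ is called a $\mu$-asymptotic rate at $x$ w.r.t. $\delta$. $T$ is $\mu$-restricted sensitive (also called measure-theoretic restricted sensitive) if for $\mu$-a.e. $x\in X$ there exists $\delta>0$ such that $T$ is $\mu$-restricted sensitive at $x$ w.r.t. $\delta$. Restricted asymptotic rates: $a_\mu(x,\delta)$ is the infimum of all $\mu$-asymptotic rates at $x$ w.r.t. $\delta$, with $a_\mu(x,\delta)=+\infty$ if there are none. It does not increase as $\delta$ decreases, and $a_\mu(x)=\lim_{\delta\to0}a_\mu(x,\delta)\in[0,+\infty]$ (with $a_\mu(x)=+\infty$ if $a_\mu(x,\delta)=+\infty$ for all $\delta>0$). Conventions: $\frac10=+\infty$ and $\frac{1}{+\infty}=0$. *)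

(* Defs.v *)
From HB Require Import structures.
From mathcomp Require Import all_boot all_order all_algebra.
From mathcomp Require Import all_classical all_reals all_analysis.

Set Implicit Arguments.
Unset Strict Implicit.
Unset Printing Implicit Defensive.

Import Order.TTheory GRing.Theory Num.Theory.
Import numFieldNormedType.Exports.

Local Open Scope classical_set_scope.
Local Open Scope ring_scope.

(* The base point is required by the library's measurable types; it costs no
   generality, since a space carrying a probability measure is nonempty. *)
#[short(type="pointedMetricType")]
HB.structure Definition PointedMetric (R : realType) :=
  {X of Metric R X & Pointed X}.

Notation borelType X := (g_sigma_algebraType (@open X)).

Section Definitions.
Context {R : realType} {X : pointedMetricType R}.
Implicit Types (mu : probability (borelType X) R) (T : X -> X) (x y : X).

Definition invariant_measure mu T :=
  forall A : set (borelType X), measurable A -> mu (T @^-1` A) = mu A.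

Definition ergodic mu T :=
  forall A : set (borelType X), measurable A -> T @^-1` A = A ->
    mu A = 0%E \/ mu A = 1%E.

(* Both endpoints included: 0 <= i <= n. *)
Definition bowen_dist T (n : nat) x y : R :=
  \big[Num.max/0]_(i < n.+1) mdist (iter i T x) (iter i T y).

Definition bowen_ball T (n : nat) x (e : R) : set X :=
  [set y | bowen_dist T n x y < e].

(* As lne 0 = -oo, the rate of a null ball is +oo. *)
Definition bowen_ball_rate mu T x (e : R) (n : nat) : \bar R :=
  (- lne (mu (bowen_ball T n x e)) / n%:R%:E)%E.

Definition lower_local_entropy mu T x : \bar R :=
  lim (limn_einf (bowen_ball_rate mu T x e) @[e --> 0^'+]).

Definition upper_local_entropy mu T x : \bar R :=
  lim (limn_esup (bowen_ball_rate mu T x e) @[e --> 0^'+]).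

(* The local entropy is defined only at the points where the two limits agree,
   which is why it is a relation between x and its value h. *)
Definition is_local_entropy mu T x (h : \bar R) :=
  lower_local_entropy mu T x = h /\ upper_local_entropy mu T x = h.

Definition asymptotic_rate mu T x (d a : R) :=
  0 < a /\
  forall V : set (borelType X), measurable V -> (0 < mu V)%E ->
    exists n : nat, (n%:R%:E <= - (a%:E * lne (mu V)))%E /\
      (0 < mu (V `&` [set y | (d < mdist (iter n T x) (iter n T y))%R]))%E.

Definition restricted_sensitive_at mu T x (d : R) :=
  exists a : R, asymptotic_rate mu T x d a.

Definition restricted_sensitive mu T :=
  {ae mu, forall x, exists2 d : R, 0 < d & restricted_sensitive_at mu T x d}.

(* The infimum of the empty set is +oo. *)
Definition restricted_rate_at mu T x (d : R) : \bar R :=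
  ereal_inf [set a%:E | a in [set a | asymptotic_rate mu T x d a]].

Definition restricted_rate mu T x : \bar R :=
  lim (restricted_rate_at mu T x d @[d --> 0^'+]).

(* Cells are allowed to be empty. *)
Definition measurable_partition (k : nat) (P : 'I_k -> set (borelType X)) :=
  [/\ forall i, measurable (P i),
      trivIset [set: 'I_k] P &
      \bigcup_(i in [set: 'I_k]) P i = [set: X]].

(* The cell, labelled by the word w, of the join of P, T^-1 P, ..., T^-(n-1) P. *)
Definition join_cell T (k : nat) (P : 'I_k -> set (borelType X)) (n : nat)
    (w : {ffun 'I_n -> 'I_k}) : set (borelType X) :=
  \bigcap_(i in [set: 'I_n]) (iter i T @^-1` P (w i)).

(* As ln 0 = 0, null cells contribute 0. *)
Definition join_entropy mu T (k : nat) (P : 'I_k -> set (borelType X))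
    (n : nat) : R :=
  - \sum_(w : {ffun 'I_n -> 'I_k})
      (fine (mu (join_cell T P w)) * ln (fine (mu (join_cell T P w)))).

Definition partition_entropy mu T (k : nat) (P : 'I_k -> set (borelType X)) : R :=
  limn (fun n : nat => join_entropy mu T P n / n%:R).

Definition measure_entropy mu T : \bar R :=
  ereal_sup [set h : \bar R | exists (k : nat) (P : 'I_k -> set (borelType X)),
    measurable_partition P /\ h = (partition_entropy mu T P)%:E].

End Definitions.

(* Main.v *)
Require Import Defs.
From HB Require Import structures.
From mathcomp Require Import all_boot all_order all_algebra.
From mathcomp Require Import all_classical all_reals all_analysis.
From mathcomp Require Import measurable_realfun.
From mathcomp Require Import lra ring zify.

Set Implicit Arguments.
Unset Strict Implicit.
Unset Printing Implicit Defensive.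

Import Order.TTheory GRing.Theory Num.Theory.
Import numFieldNormedType.Exports.

Local Open Scope classical_set_scope.
Local Open Scope ring_scope.

(** Everything rests on one covering theorem, [slow_cover].  Fix a radius e
    and call a point slow, with exponent a, when mu(B_n(x,e)) exceeds
    exp(-a' n) for infinitely many n, for each a' > a; this is the set where
    the liminf of -log mu(B_n(x,e)) / n is at most a.  Slowness passes from x
    to T x.  For each b > a, all slow points outside a set of small measure can,
    for every N at once, be covered by at most C exp(b N) open sets of points
    whose orbits stay 4e-close up to time N.  Indeed most times i of the orbit
    of a slow point see a heavy ball B_n(T^i x,e) of a length n between two
    fixed bounds, so the orbit is cut greedily into heavy blocks and a few
    single bad times ([coverable_greedy]).  Points of heavy balls of length n
    are covered by exp(a' n) doubled balls, because disjoint heavy balls are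
    that few ([coverable_heavy]); a bad time costs a constant, by compactness;
    and bad times have small frequency at all N simultaneously by the maximal
    ergodic inequality ([maximal_ergodic_inequality]).

    Existence of the local entropy.  In a cover by C exp(b' N) sets, the union
    of the sets lighter than exp(-b N), b > b', has summable measure.  By
    Borel-Cantelli, almost every slow point ends up in heavy sets of the
    covers, and these lie in its 4e-balls; so the limsup at radius 4e is at
    most the liminf at radius e ([slow_ball_lower_bound],
    [local_entropy_exists]).

    The rate.  That a is an asymptotic rate at x with respect to d says that
    no V of positive measure is essentially contained in the Bowen ball of
    length floor(-a log mu(V)).  Testing this on V = B_k(x,d) shows that balls
    decay at least like exp(-k/a) ([asymptotic_rate_decay]); conversely decay
    like exp(-c k) makes every a > 1/c a rate for d small
    ([decay_asymptotic_rate]).  Hence the restricted rate is, at every point,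
    the inverse of the lower local entropy ([restricted_rate_inv]).

    Entropy.  If almost every point is sensitive, balls of a fixed radius decay
    at a fixed exponential speed on a set of positive measure; a partition
    into cells smaller than this radius then has cells as light as the balls,
    and positive entropy ([restricted_sensitive_entropy_gt0]).  If sensitivity
    fails on a set of positive measure, ergodicity makes almost every point
    slow with exponent 0 at every radius, so the covers above grow
    subexponentially.  A finite partition is locally constant at a uniform
    scale outside a small set ([almost_clopen_measurable]); so two points with
    close orbits have itineraries that differ at few times, and counting
    Hamming balls bounds the number of itineraries, hence the entropy, by a
    subexponential quantity ([partition_entropy_zero]). *)

(** * Probabilities as real numbers *)

Lemma exists_natSinv_le (R : realType) (e : R) :
  0 < e -> exists n : nat, n.+1%:R^-1 <= e.
Proof.
move=> e0; exists (Num.truncn e^-1).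
by rewrite -[leRHS]invrK lef_pV2 ?posrE ?invr_gt0// ltW// truncnS_gt.
Qed.

Section RealProbability.
Context {d : measure_display} {T : measurableType d} {R : realType}.
Implicit Types (mu : probability T R) (A B : set T).

(** Measures of sets are finite here, so that all estimates can be made by
    linear arithmetic in [R] instead of the extended reals. *)
Definition pr mu A : R := fine (mu A).

Lemma prE mu A : measurable A -> mu A = (pr mu A)%:E.
Proof. by move=> mA; rewrite /pr fineK// fin_num_measure. Qed.

Lemma pr_ge0 mu A : 0 <= pr mu A.
Proof. by rewrite /pr fine_ge0. Qed.

Lemma pr_le mu A B : measurable A -> measurable B -> A `<=` B ->
  pr mu A <= pr mu B.
Proof.
by move=> mA mB AB; rewrite -lee_fin -!prE// le_measure// inE.
Qed.

Lemma pr_le1 mu A : measurable A -> pr mu A <= 1.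
Proof. by move=> mA; rewrite -lee_fin -prE// probability_le1. Qed.

Lemma prT mu : pr mu setT = 1.
Proof. by rewrite /pr probability_setT. Qed.

Lemma prC mu A : measurable A -> pr mu (~` A) = 1 - pr mu A.
Proof.
move=> mA; apply: EFin_inj.
by rewrite EFinB -!prE ?probability_setC//; exact: measurableC.
Qed.

Lemma prU_le mu A B : measurable A -> measurable B ->
  pr mu (A `|` B) <= pr mu A + pr mu B.
Proof.
move=> mA mB; rewrite -lee_fin EFinD -!prE//; last exact: measurableU.
exact: measureU2.
Qed.

Lemma pr_le_addD mu A B : measurable A -> measurable B ->
  pr mu A <= pr mu B + pr mu (A `\` B).
Proof.
move=> mA mB; have mD := measurableD mA mB.
apply: (le_trans _ (prU_le mu mB mD)); apply: pr_le => //; first exact: measurableU.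
by move=> x Ax; have [|] := pselect (B x); [left|right].
Qed.

Lemma pr_bigsetU_le mu (I : Type) (s : seq I) (P : pred I) (F : I -> set T) :
  (forall i, measurable (F i)) ->
  pr mu (\big[setU/set0]_(i <- s | P i) F i) <= \sum_(i <- s | P i) pr mu (F i).
Proof.
move=> mF; elim: s => [|i s IH]; first by rewrite !big_nil /pr measure0.
rewrite !big_cons; case: ifP => // _.
apply: (le_trans (prU_le _ _ _)) => //; last by rewrite lerD2l.
exact: bigsetU_measurable.
Qed.

Lemma pr_noninc_small mu (D : nat -> set T) (th : R) :
  (forall n, measurable (D n)) -> (forall n, D n.+1 `<=` D n) ->
  \bigcap_n D n = set0 -> 0 < th -> exists n, pr mu (D n) <= th.
Proof.
move=> mD decD D0 th0.
have cv : mu (D n) @[n --> \oo] --> 0%E.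
  rewrite -(measure0 mu) -D0; apply: nonincreasing_cvg_mu => //.
  - by rewrite -ge0_fin_numE// fin_num_measure.
  - exact: bigcap_measurable.
  - by apply/nonincreasing_seqP => n; apply/subsetPset; exact: decD.
have /fine_cvgP[_ /cvgrPdist_le/(_ _ th0)[N _ /(_ N (leqnn _))]] := cv.
by rewrite /= sub0r normrN => /ler_normlP[_ ?]; exists N.
Qed.

Lemma pr_approx_bigcup mu E (F : nat -> set T) (th : R) :
  measurable E -> (forall n, measurable (F n)) -> (forall n, F n `<=` F n.+1) ->
  E `<=` \bigcup_n F n -> 0 < th -> exists n, pr mu (E `\` F n) <= th.
Proof.
move=> mE mF incF EF th0; apply: pr_noninc_small => //.
- by move=> n; exact: measurableD.
- by move=> n x [Ex nF]; split => // /incF.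
- rewrite -subset0 => x h.
  by have [Ex _] := h 0%N I; have [n _ Fn] := EF _ Ex; have [_] := h n I; apply.
Qed.

Lemma negligible_small mu A :
  (forall th : R, 0 < th -> exists2 B, measurable B & A `<=` B /\ pr mu B <= th) ->
  mu.-negligible A.
Proof.
move=> h.
have /choice[B hB] : forall n : nat, exists B, [/\ measurable B, A `<=` B &
    pr mu B <= n.+1%:R^-1].
  move=> n; have [|B mB [AB Bn]] := h n.+1%:R^-1; first by rewrite invr_gt0.
  by exists B.
exists (\bigcap_n B n); split; last by move=> x Ax n _; have [_ + _] := hB n; exact.
  by apply: bigcap_measurable => // n _; have [] := hB n.
have mI : measurable (\bigcap_n B n).
  by apply: bigcap_measurable => // n _; have [] := hB n.
apply: etrans (prE mu mI) _; congr EFin; apply/eqP.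
rewrite eq_le pr_ge0 andbT; apply/ler_addgt0Pr => e e0; rewrite add0r.
have [n ne] := exists_natSinv_le e0.
apply: le_trans ne; have [mB _ +] := hB n.
by apply: le_trans; apply: pr_le => // x; apply.
Qed.

Lemma ae_imp mu (P Q : T -> Prop) : (forall x, P x -> Q x) ->
  {ae mu, forall x, P x} -> {ae mu, forall x, Q x}.
Proof. by move=> PQ; apply: negligibleS => x /= nQ Px; apply: nQ; exact: PQ. Qed.

End RealProbability.

(** * Maximal ergodic inequality *)

Section MaximalInequality.

Section Blocks.
Context {R : realType} (eta : R) (M : nat).
Implicit Type b : nat -> bool.

(** A maximal-function argument in its combinatorial form: [b j] marks the
    visits to a set, and a position is dense when some block of length at most
    [M] starting there has frequency of marks above [eta]. *)
Definition dense_block b (i : nat) :=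
  [exists n : 'I_M.+1, eta * n%:R < \sum_(0 <= j < n) (b (i + j)%N)%:R].

Lemma dense_block_shift b n i :
  dense_block b (n + i) = dense_block (fun j => b (n + j)%N) i.
Proof.
by apply: eq_existsb => k; under eq_bigr do rewrite -addnA.
Qed.

Lemma sum_dense_block_le b (m n : nat) : 0 <= eta -> (m <= n)%N ->
  eta * \sum_(m <= i < n) (dense_block b i)%:R <= eta * (n - m)%N%:R.
Proof.
move=> eta0 mn; apply: ler_wpM2l => //; apply: (le_trans (ler_sum _ (G := fun=> 1) _)).
  by move=> i _; rewrite lern1 leq_b1.
by rewrite big_const_nat iter_addr addr0.
Qed.

(** Scan the positions from the left.  A position that is not dense adds
    nothing on the left-hand side; at a dense one the scan jumps over its
    block, whose marks alone pay for eta times its length.  The last block may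
    stick out of the range, by at most [M]. *)
Lemma sum_dense_block (L : nat) b : 0 <= eta ->
  eta * \sum_(0 <= i < L) (dense_block b i)%:R <= \sum_(0 <= j < L + M) (b j)%:R.
Proof.
move=> eta0; elim/ltn_ind: L b => -[|L] IH b.
  by rewrite big_nil mulr0 sumr_ge0.
have [/existsP[n]|g0] := boolP (dense_block b 0); last first.
  rewrite big_ltn// (negbTE g0) add0r addSn [leRHS]big_nat_recl// big_add1/=.
  under eq_bigr do rewrite -add1n dense_block_shift.
  rewrite -[leLHS]add0r lerD//.
  exact: (IH L (ltnSn _) (fun j => b j.+1)).
under eq_bigr do rewrite add0n.
move=> gn; have n0 : (0 < n)%N.
  by rewrite lt0n; apply: contraPneq gn => ->; rewrite mulr0 big_nil ltxx.
have [Ln|nL] := leqP L.+1 n.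
  (* The block reaches beyond the range: it pays for all that remains. *)
  apply: (le_trans (sum_dense_block_le _ _ _)) => //.
  have : eta * L.+1%:R <= eta * n%:R by rewrite ler_wpM2l// ler_nat.
  rewrite subn0 => /le_trans; apply; apply: (le_trans (ltW gn)).
  rewrite [leRHS](@big_cat_nat _ _ _ n)//=; last by have := ltn_ord n; lia.
  by rewrite lerDl sumr_ge0.
rewrite (@big_cat_nat _ _ _ n)//=; last exact: ltnW.
rewrite [leRHS](@big_cat_nat _ _ _ n)//=; last lia.
rewrite mulrDr lerD//.
  by apply: (le_trans (sum_dense_block_le _ _ _)) => //; rewrite subn0 ltW.
have shift (F : nat -> R) p :
    \sum_(n <= i < p) F i = \sum_(0 <= i < p - n) F (n + i)%N.
  rewrite -{1}[n : nat]add0n big_addn.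
  by apply: eq_bigr => i _; rewrite addnC.
rewrite !shift; under eq_bigr do rewrite dense_block_shift.
rewrite (_ : (L.+1 + M - n = L.+1 - n + M)%N); last lia.
by apply: (IH (L.+1 - n)%N); lia.
Qed.

End Blocks.

Context {d : measure_display} {T : measurableType d} {R : realType}.
Context (mu : probability T R) (tau : T -> T).
Context (mtau : forall A, measurable A -> measurable (tau @^-1` A)).
Context (invtau : forall A, measurable A -> mu (tau @^-1` A) = mu A).
Implicit Types (A B : set T) (x : T).

Definition visits x B (n : nat) : nat := \sum_(0 <= i < n) (iter i tau x \in B).

Lemma visits_le x B n : (visits x B n <= n)%N.
Proof.
rewrite -[leqRHS](subn0 n) -[leqRHS]muln1 -sum_nat_const_nat.
by apply: leq_sum => i _; exact: leq_b1.
Qed.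

Lemma measurable_iter n A : measurable A -> measurable (iter n tau @^-1` A).
Proof. by elim: n A => // n IH A mA; apply: (IH (tau @^-1` A)); apply: mtau. Qed.

Lemma pr_iter n A : measurable A -> pr mu (iter n tau @^-1` A) = pr mu A.
Proof.
rewrite /pr => mA; congr fine; elim: n A mA => // n IH A mA.
by rewrite -[RHS]invtau// -[RHS]IH//; exact: mtau.
Qed.

(** The count takes finitely many values, so its level sets suffice, and those
    are computed by recursion on [n]. *)
Lemma measurable_visits B n (P : pred nat) : measurable B ->
  measurable [set x | P (visits x B n)].
Proof.
move=> mB; rewrite (_ : mkset _ = \bigcup_(k in [set k | P k /\ (k <= n)%N])
   [set x | visits x B n = k]); last first.
  apply/seteqP; split => [x /= Px|x [k /= [Pk _]] /= ->//].
  exists (visits x B n) => //; split => //=.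
  exact: visits_le.
apply: bigcup_measurable => k _ {P}.
elim: n k => [|n IH] k.
  rewrite (_ : mkset _ = if (0 == k)%N then setT else set0); first by case: ifP.
  apply/seteqP; split => x; rewrite /= /visits big_geq//=.
    by move=> ->; rewrite eqxx.
  by case: ifPn => // /eqP.
rewrite (_ : mkset _ = ((iter n tau @^-1` B) `&` [set x | visits x B n = k.-1 /\ (0 < k)%N])
   `|` ((~` (iter n tau @^-1` B)) `&` [set x | visits x B n = k])); last first.
  apply/seteqP; split => x; rewrite /= /visits big_nat_recr//= => h.
    have [Bx|Bx] := boolP (iter n tau x \in B); [left|right]; split.
    - by rewrite /= -inE.
    - by move: h; rewrite Bx addn1/= => <-.
    - by rewrite notin_setE in Bx.
    - by move: h; rewrite (negbTE Bx) addn0.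
  case: h => -[/= Bx].
    by rewrite -in_setE in Bx; rewrite Bx => -[-> ?]; rewrite addn1 prednK.
  by rewrite memNset// => ->; rewrite addn0.
apply: measurableU; apply: measurableI.
- exact: measurable_iter.
- case: k => [|k].
    by rewrite (_ : mkset _ = set0)//; apply/seteqP; split => x // -[].
  rewrite (_ : mkset _ = [set x | visits x B n = k])//.
  by apply/seteqP; split => x /=; [case|].
- by apply: measurableC; exact: measurable_iter.
- exact: IH.
Qed.

Definition rarely_visiting B (eta : R) : set T :=
  [set x | forall n, (visits x B n)%:R <= eta * n%:R].

Lemma measurable_rarely_visiting B eta :
  measurable B -> measurable (rarely_visiting B eta).
Proof.
move=> mB; rewrite (_ : rarely_visiting _ _ =
    \bigcap_n [set x | (fun k => k%:R <= eta * n%:R) (visits x B n)]).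
  apply: bigcap_measurable => // n _.
  exact: (measurable_visits n (fun k => k%:R <= eta * n%:R)).
by apply/seteqP; split => x h n; [move=> _; exact: (h n)|exact: (h n I)].
Qed.

Lemma indic_iter i A :
  (fun x => (iter i tau x \in A)%:R : R) = \1_(iter i tau @^-1` A).
Proof. by apply/funext => x; rewrite indicE; congr (_%:R); apply/idP/idP; rewrite !inE. Qed.

Lemma measurable_indic_iter i A : measurable A ->
  measurable_fun [set: T] (fun x => (iter i tau x \in A)%:R : R).
Proof.
by move=> mA; rewrite indic_iter; apply: measurable_indic; exact: measurable_iter.
Qed.

Lemma integral_indic_iter i A : measurable A ->
  (\int[mu]_x ((iter i tau x \in A)%:R)%:E)%E = (pr mu A)%:E.
Proof.
move=> mA; have mi := measurable_iter i mA.
under eq_integral => x _ do rewrite -[_%:R]/((fun x => (iter i tau x \in A)%:R) x) indic_iter.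
by rewrite integral_indic// setIT; apply: etrans (prE mu mi) _; rewrite pr_iter.
Qed.

Lemma integral_sum_visits (c : R) (n : nat) (A : set T) : 0 <= c -> measurable A ->
  (\int[mu]_x (\sum_(0 <= i < n) c * (iter i tau x \in A)%:R)%:E)%E =
  (n%:R * (c * pr mu A))%:E.
Proof.
move=> c0 mA.
have mi i : measurable_fun [set: T] (fun x => ((iter i tau x \in A)%:R : R)%:E).
  by apply/measurable_EFinP; exact: measurable_indic_iter.
under eq_integral do rewrite -sumEFin.
under eq_integral do under eq_bigr do rewrite EFinM.
rewrite ge0_integral_sum//=; last 2 first.
- by move=> i; apply: measurable_funeM.
- by move=> i x _; rewrite mule_ge0// lee_fin.
under eq_bigr => i _.
  rewrite ge0_integralZl_EFin//.
  rewrite integral_indic_iter//.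
  over.
apply: etrans (sumEFin _ _ (fun=> c * pr mu A)) _.
by rewrite sumr_const_nat subn0 mulr_natl.
Qed.

Definition dense_at B (eta : R) (M : nat) : set T :=
  [set x | exists n : 'I_M.+1, eta * n%:R < (visits x B n)%:R].

Lemma measurable_dense_at B eta M : measurable B -> measurable (dense_at B eta M).
Proof.
move=> mB; rewrite (_ : dense_at _ _ _ = \bigcup_(n in [set n | (n < M.+1)%N])
   [set x | (fun k => eta * n%:R < k%:R) (visits x B n)]).
  apply: bigcup_measurable => n _.
  exact: (measurable_visits n (fun k => eta * n%:R < k%:R)).
apply/seteqP; split => x /=; first by move=> [n hn]; exists n => /=.
by move=> [n /= nM hn]; exists (Ordinal nM).
Qed.

(** Integrate [sum_dense_block] along orbits: by invariance, each of the first
    [L] positions contributes the same measure, so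
    eta L pr(dense) <= (L + M) pr(B), and [L] is arbitrary. *)
Lemma pr_dense_at B eta M : measurable B -> 0 <= eta ->
  eta * pr mu (dense_at B eta M) <= pr mu B.
Proof.
move=> mB eta0; set A := dense_at B eta M.
have mA : measurable A by exact: measurable_dense_at.
have step (L : nat) : L%:R * (eta * pr mu A) <= (L + M)%N%:R * pr mu B.
  rewrite -lee_fin -(integral_sum_visits L eta0 mA) -[pr mu B]mul1r.
  rewrite -(integral_sum_visits _ _ mB)//.
  apply: ge0_le_integral => //.
  - by move=> x _; rewrite lee_fin sumr_ge0// => i _; rewrite mulr_ge0.
  - apply/measurable_EFinP.
    apply: measurable_sum => i; apply: measurable_funM => //.
    exact: measurable_indic_iter.
  - apply/measurable_EFinP.
    apply: measurable_sum => i; apply: measurable_funM => //.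
    exact: measurable_indic_iter.
  move=> x _; rewrite lee_fin -mulr_sumr.
  under [leRHS]eq_bigr do rewrite mul1r.
  apply: le_trans (sum_dense_block M L (fun i => iter i tau x \in B) eta0).
  rewrite le_eqVlt; apply/orP; left; apply/eqP; congr (_ * _).
  apply: eq_bigr => i _; congr (_%:R); congr nat_of_bool.
  apply/idP/existsP => [|[n hn]]; rewrite ?inE.
    move=> [n]; rewrite /visits natr_sum => hn; exists n; apply: (lt_le_trans hn).
    by rewrite ler_sum// => j _; rewrite addnC iterD.
  exists n; rewrite /visits natr_sum; apply: (lt_le_trans hn).
  by rewrite ler_sum// => j _; rewrite addnC iterD.
rewrite leNgt; apply/negP => lt.
(* If the claim failed, this many positions would absorb the overhang M. *)
have := step (Num.truncn (M%:R * pr mu B / (eta * pr mu A - pr mu B))).+1.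
set L := _.+1; apply/negP; rewrite -ltNge natrD mulrDl -ltrBrDl -mulrBr.
by rewrite -ltr_pdivrMr ?subr_gt0// truncnS_gt.
Qed.

(** The frequencies of visits are bounded for all lengths at once.  A Markov
    bound at each length would not do: almost sure statements below need one
    large set that is good for every length. *)
Theorem maximal_ergodic_inequality B eta : measurable B -> 0 <= eta ->
  eta * pr mu (~` rarely_visiting B eta) <= pr mu B.
Proof.
move=> mB eta0; apply/ler_addgt0Pr => e e0.
have mA M : measurable (dense_at B eta M) by exact: measurable_dense_at.
have mG := measurableC (measurable_rarely_visiting eta mB).
have e1 : 0 < e / (eta + 1) by rewrite divr_gt0// ltr_wpDl.
have [|x /=|M hM] := pr_approx_bigcup mu mG mA _ _ e1.
- move=> M x [n hn].
  by exists (widen_ord (leqnSn M.+1) n).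
- move=> /existsNP[n /negP]; rewrite -ltNge => hn; exists n => //.
  by exists ord_max.
have := pr_le_addD mu mG (mA M).
move=> /(ler_wpM2l eta0)/le_trans; apply; rewrite mulrDr lerD ?pr_dense_at//.
apply: (le_trans (ler_wpM2l eta0 hM)).
rewrite mulrCA -[leRHS]mulr1 ler_pM2l// ler_pdivrMr ?ltr_wpDl//; lra.
Qed.

End MaximalInequality.

(** * Borel sets and Bowen balls *)

Section BorelSets.
Context {R : realType} {X : pointedMetricType R}.

Lemma open_measurable_borel (A : set X) : open A -> measurable (A : set (borelType X)).
Proof. exact: sub_sigma_algebra. Qed.

Lemma borel_ind (P : set X -> Prop) : sigma_algebra setT P ->
  (forall A, open A -> P A) ->
  forall A : set (borelType X), measurable A -> P A.
Proof. by move=> sP oP A; exact: (smallest_sub sP). Qed.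

End BorelSets.

Section BowenBalls.
Context {R : realType} {X : pointedMetricType R} (T : X -> X).
Implicit Types (x y : X) (n : nat) (e : R).

Lemma bowen_ballP n x e y : 0 < e ->
  bowen_ball T n x e y <-> forall i, (i <= n)%N -> mdist (iter i T x) (iter i T y) < e.
Proof.
move=> e0; rewrite /bowen_ball /bowen_dist /=; split.
  move=> /bigmax_ltP[_ h] i ni.
  exact: (h (Ordinal (ni : (i < n.+1)%N))).
by move=> h; apply/bigmax_ltP; split => // i _; apply: h; rewrite -ltnS.
Qed.

Lemma bowen_ball_center n x e : 0 < e -> bowen_ball T n x e x.
Proof. by move=> e0; apply/bowen_ballP => // i _; rewrite mdistxx. Qed.

Lemma bowen_ball_sym n x y e : 0 < e -> bowen_ball T n x e y -> bowen_ball T n y e x.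
Proof.
move=> e0 /(bowen_ballP _ _ _ e0) h; apply/bowen_ballP => // i ni.
by rewrite metric_sym; exact: h.
Qed.

Lemma bowen_ball_triangle n x y z e f : 0 < e -> 0 < f ->
  bowen_ball T n x e y -> bowen_ball T n y f z -> bowen_ball T n x (e + f) z.
Proof.
move=> e0 f0 /(bowen_ballP _ _ _ e0) xy /(bowen_ballP _ _ _ f0) yz.
apply/bowen_ballP => [|i ni]; first exact: addr_gt0.
by apply: le_lt_trans (metric_triangle _ (iter i T y) _) _; rewrite ltrD ?xy ?yz.
Qed.

Lemma bowen_ball_le n x e f : 0 < e -> e <= f ->
  bowen_ball T n x e `<=` bowen_ball T n x f.
Proof. by move=> e0 ef y; rewrite /bowen_ball/= => /lt_le_trans; exact. Qed.

(** One step of the dynamics loses one unit of length; this is what makes slow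
    decay of balls pass from a point to its image. *)
Lemma bowen_ball_step n x e : 0 < e ->
  bowen_ball T n.+1 x e `<=` T @^-1` bowen_ball T n (T x) e.
Proof.
move=> e0 y /(bowen_ballP _ _ _ e0) h; apply/bowen_ballP => // i ni.
by rewrite -!iterSr; exact: h.
Qed.

Context (contT : continuous T).

Lemma continuous_iter n : continuous (iter n T).
Proof.
elim: n => [|n IH] x; first exact: cvg_id.
by apply: continuous_comp; [exact: IH|exact: contT].
Qed.

Lemma open_preimage_iter n (A : set X) : open A -> open (iter n T @^-1` A).
Proof. by apply: open_comp => x _; exact: continuous_iter. Qed.

Lemma open_mdist_ball x e : open [set y | mdist x y < e].
Proof.
rewrite openE => y /= xy; rewrite /interior.
apply/nbhs_ballP; exists (e - mdist x y); first by rewrite /= subr_gt0.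
move=> z; rewrite ballEmdist /= ltrBrDl => /(le_lt_trans _); apply.
exact: metric_triangle.
Qed.

Lemma open_bowen_ball n x e : 0 < e -> open (bowen_ball T n x e).
Proof.
move=> e0; rewrite (_ : bowen_ball _ _ _ _ = \bigcap_(i in [set i | (i < n.+1)%N])
    (iter i T @^-1` [set y | mdist (iter i T x) y < e])).
  rewrite bigcap_mkord; apply: big_ind => [||i _].
  - exact: openT.
  - exact: openI.
  - by apply: open_preimage_iter; exact: open_mdist_ball.
by apply/seteqP; split => y; [move=> /(bowen_ballP _ _ _ e0)
  |move=> ?; apply/bowen_ballP].
Qed.

Lemma measurable_bowen_ball n x e : 0 < e ->
  measurable (bowen_ball T n x e : set (borelType X)).
Proof. by move=> e0; apply: open_measurable_borel; exact: open_bowen_ball. Qed.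

Lemma measurable_preimage_borel (A : set (borelType X)) :
  measurable A -> measurable (T @^-1` A : set (borelType X)).
Proof.
apply: (borel_ind (P := fun A => measurable (T @^-1` A : set (borelType X)))).
  split => /=.
  - by rewrite preimage_set0.
  - by move=> B mB; rewrite setTD preimage_setC; exact: measurableC.
  - by move=> F mF; rewrite preimage_bigcup; exact: bigcup_measurable.
by move=> B oB; apply: open_measurable_borel; exact: (open_preimage_iter 1).
Qed.

End BowenBalls.

(** * Covers by sets of points with close orbits *)

Section Covers.
Context {R : realType} {X : pointedMetricType R} (T : X -> X) (e : R).
Context (contT : continuous T).

Definition orbit_close (n : nat) (A : set X) :=
  forall y z, A y -> A z -> forall i, (i < n)%N -> mdist (iter i T y) (iter i T z) < e.

(** Index types, rather than lists, carry the cardinality: unions of covers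
    become sums of types, and concatenations in time become products. *)
Definition coverable (n : nat) (S : set X) (c : R) :=
  exists (I : finType) (A : I -> set X),
    [/\ #|I|%:R <= c, forall i, open (A i), forall i, orbit_close n (A i) &
        S `<=` \bigcup_i A i].

Lemma coverable_le n S S' c c' : S' `<=` S -> c <= c' ->
  coverable n S c -> coverable n S' c'.
Proof.
move=> SS' cc' [I [A [Ic oA sA SA]]]; exists I, A; split => //.
  exact: le_trans cc'.
exact: subset_trans SA.
Qed.

Lemma coverable0 S c : 1 <= c -> coverable 0 S c.
Proof.
move=> c1; exists unit, (fun=> setT); split => //.
- by rewrite card_unit.
- by move=> _; exact: openT.
- by move=> x _; exists tt.
Qed.

Lemma coverable_set0 n c : 0 <= c -> coverable n set0 c.
Proof. by move=> c0; exists void, (fun=> set0); split; [rewrite card_void|case|case|]. Qed.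

Lemma coverable_bigcup n (J : finType) (S : J -> set X) (c : J -> R) :
  (forall j, coverable n (S j) (c j)) ->
  coverable n (\bigcup_j S j) (\sum_j c j).
Proof.
move=> cov.
have h j := svalP (cid (svalP (cid (cov j)))).
set I := fun j => sval (cid (cov j)) in h.
set A : forall j, I j -> set X := fun j => sval (cid (svalP (cid (cov j)))) in h.
exists {j : J & I j}, (fun u => A (tag u) (tagged u)); split.
- rewrite card_tagged sumnE big_map big_enum/= natr_sum ler_sum// => j _.
  by have [] := h j.
- by move=> [j i]; have [_ oA _ _] := h j; exact: oA.
- by move=> [j i]; have [_ _ sA _] := h j; exact: sA.
- move=> x [j _ Sx]; have [_ _ _ /(_ _ Sx)[i _ Ax]] := h j.
  by exists (Tagged I i).
Qed.

Lemma coverableU n S1 S2 c1 c2 : coverable n S1 c1 -> coverable n S2 c2 ->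
  coverable n (S1 `|` S2) (c1 + c2).
Proof.
move=> h1 h2; have := @coverable_bigcup n bool (fun b => if b then S1 else S2)
  (fun b => if b then c1 else c2).
rewrite big_bool => h; apply: coverable_le (h _) => //; last by case.
by move=> x [Sx|Sx]; [exists true|exists false].
Qed.

(** A block of length [n] followed by one of length [m].  The total length may
    exceed [k]: a block is allowed to run over the end of the segment. *)
Lemma coverable_concat n m k S1 S2 c1 c2 : (k <= n + m)%N ->
  coverable n S1 c1 -> coverable m S2 c2 ->
  coverable k (S1 `&` iter n T @^-1` S2) (c1 * c2).
Proof.
move=> knm [I [A [Ic oA sA SA]]] [J [B [Jc oB sB SB]]].
exists (I * J)%type, (fun u => A u.1 `&` iter n T @^-1` B u.2); split.
- by rewrite card_prod natrM ler_pM.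
- by move=> [i j]; apply: openI => //; exact: open_preimage_iter.
- move=> [i j] y z /= [Ay By] [Az Bz] l lk.
  have [ln|nl] := ltnP l n; first exact: (sA i).
  by rewrite -(subnK nl) !iterD; apply: (sB j) => //; lia.
- move=> x [S1x S2x]; have [i _ Ax] := SA _ S1x; have [j _ Bx] := SB _ S2x.
  by exists (i, j).
Qed.

End Covers.

(** * Heavy Bowen balls *)

Section HeavyBalls.
Context {R : realType} {X : pointedMetricType R} (T : X -> X).
Context (mu : probability (borelType X) R).
Context (contT : continuous T).
Implicit Types (x y : X) (n : nat) (e c : R).

Notation ball_pr n x e := (pr mu (bowen_ball T n x e)).

Definition heavy n e c : set X := [set x | c < ball_pr n x e].

(** The measure of [B_n(x,e)] is lower semicontinuous in [x]: most of it sits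
    in a slightly smaller concentric ball, which lies in [B_n(y,e)] for [y]
    near [x]. *)
Lemma open_heavy n e c : 0 < e -> open (heavy n e c).
Proof.
move=> e0; rewrite openE => x; rewrite /heavy /= => cx; rewrite /interior.
pose F k := bowen_ball T n x (e - k.+1%:R^-1).
have oF k : open (F k).
  have [h|h] := ltP 0 (e - k.+1%:R^-1); first exact: open_bowen_ball.
  rewrite (_ : F k = set0); first exact: open0.
  apply/seteqP; split => // y; rewrite /F /bowen_ball /= => /lt_le_trans /(_ h).
  by rewrite ltNge bigmax_ge_id.
have [|||||k] := pr_approx_bigcup (E := bowen_ball T n x e) (F := F) mu
    (th := (ball_pr n x e - c) / 2).
- exact: measurable_bowen_ball.
- by move=> k; exact: open_measurable_borel.
- move=> k y; rewrite /F /bowen_ball /= => /lt_le_trans; apply.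
  by rewrite lerB// lef_pV2 ?posrE// ler_nat.
- move=> y; rewrite /bowen_ball /= => xy.
  have [|k hk] := @exists_natSinv_le R (e - bowen_dist T n x y); first by rewrite subr_gt0.
  exists k.+1 => //; rewrite /F /bowen_ball /= ltrBrDl -ltrBrDr.
  by apply: lt_le_trans hk; rewrite ltf_pV2 ?posrE// ltr_nat.
- by rewrite divr_gt0// subr_gt0.
move=> hk; rewrite nbhsE; exists (bowen_ball T n x k.+1%:R^-1) => [|y xy].
  split; last by apply: bowen_ball_center; rewrite invr_gt0.
  by apply: open_bowen_ball; rewrite ?invr_gt0.
have mF : measurable (F k : set (borelType X)) by exact: open_measurable_borel.
have mB : measurable (bowen_ball T n x e : set (borelType X)).
  exact: measurable_bowen_ball.
have FB : F k `<=` bowen_ball T n y e.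
  have [h|h] := ltP 0 (e - k.+1%:R^-1); last first.
    move=> z; rewrite /F /bowen_ball /= => /lt_le_trans /(_ h).
    by rewrite ltNge bigmax_ge_id.
  move=> z xz; rewrite -(subrK k.+1%:R^-1 e) addrC.
  by apply: bowen_ball_triangle xz => //; apply: bowen_ball_sym.
apply: (@lt_le_trans _ _ (pr mu (F k))); last first.
  by apply: pr_le => //; exact: measurable_bowen_ball.
by have := pr_le_addD mu mB mF; lra.
Qed.

Lemma measurable_heavy n e c : 0 < e -> measurable (heavy n e c : set (borelType X)).
Proof. by move=> e0; apply: open_measurable_borel; exact: open_heavy. Qed.

(** Pairwise disjoint balls of measure above [c] number at most 1/c; for a
    maximal such family the balls of double radius cover. *)
Lemma heavy_net n e c (D : set X) : 0 < e -> 0 < c -> D `<=` heavy n e c ->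
  exists s : seq X, (size s)%:R <= c^-1 /\
    D `<=` [set y | exists2 x, x \in s & bowen_ball T n x (2 * e) y].
Proof.
move=> e0 c0 Dh; pose B x := bowen_ball T n x e.
have mB x : measurable (B x : set (borelType X)) by exact: measurable_bowen_ball.
pose disj (s : seq X) := pairwise (fun x y => `[< B x `&` B y = set0 >]) s.
have bnd s : {in s, forall x, D x} -> disj s -> (size s)%:R <= c^-1.
  move=> sD sd; rewrite -[leRHS]mul1r ler_pdivlMr//.
  have h : (size s)%:R * c <= pr mu (\big[setU/set0]_(x <- s) B x).
    elim: s sD sd => [|x s IH] sD; first by rewrite mul0r pr_ge0.
    rewrite /disj /= => /andP[/allP xs sd].
    rewrite big_cons /pr measureU//=; last 2 first.
    - exact: bigsetU_measurable.
    - rewrite -bigcup_seq -subset0 => z [xz [y /= ys yz]].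
      by have /asboolP/seteqP[h _] := xs _ ys; apply: (h z).
    rewrite fineD ?fin_num_measure//; last exact: bigsetU_measurable.
    rewrite -/(pr mu _) -/(pr mu _) -[(size s).+1]add1n natrD mulrDl mul1r lerD//.
      by apply/ltW; apply: Dh; apply: sD; rewrite mem_head.
    by apply: IH => // y ys; apply: sD; rewrite in_cons ys orbT.
  by apply: (le_trans h); apply: pr_le1; exact: bigsetU_measurable.
pose P k := `[< exists s, [/\ size s = k, {in s, forall x, D x} & disj s] >].
have exP : exists k, P k by exists 0%N; apply/asboolP; exists [::].
have ubP k : P k -> (k <= Num.truncn c^-1)%N.
  move=> /asboolP[s [<- sD sd]]; rewrite truncn_ge_nat; first exact: bnd.
  by rewrite invr_ge0 ltW.
case: (ex_maxnP exP ubP) => k /asboolP[s [sk sD sd]] kmax.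
exists s; split; first exact: bnd.
move=> y Dy /=; apply: contrapT => ny.
have : P k.+1.
  apply/asboolP; exists (y :: s); split; first by rewrite /= sk.
    by move=> x; rewrite in_cons => /predU1P[->|/sD].
  apply/andP; split=> //; apply/allP => x xs; apply/asboolP.
  rewrite -subset0 => z [yz xz]; apply: ny; exists x => //.
  rewrite mulr_natl mulr2n; apply: bowen_ball_triangle xz _ => //.
  exact: bowen_ball_sym.
by move=> /kmax; rewrite ltnn.
Qed.

Lemma coverable_heavy n e c : 0 < e -> 0 < c ->
  coverable T (4 * e) n.+1 (heavy n e c) c^-1.
Proof.
move=> e0 c0; have [s [sc hs]] := heavy_net e0 c0 (@subset_refl _ (heavy n e c)).
have e20 : 0 < 2 * e by rewrite mulr_gt0.
exists 'I_(size s), (fun i : 'I_(size s) => bowen_ball T n (nth point s i) (2 * e)); split.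
- by rewrite card_ord.
- by move=> i; exact: open_bowen_ball.
- move=> i y z /(bowen_ball_sym e20) iy iz j jn.
  have /bowen_ballP h := bowen_ball_triangle e20 e20 iy iz.
  apply: (lt_le_trans (h _ _ jn)); lra.
- move=> y /hs /= [x xs xy]; move: (xs); rewrite -index_mem => xi.
  by exists (Ordinal xi) => //=; rewrite nth_index.
Qed.

Lemma coverable1 e : 0 < e -> compact [set: X] -> exists K : R, coverable T e 1 setT K.
Proof.
move=> e0; rewrite (@compact_cover X) => cX.
have e20 : 0 < e / 2 by rewrite divr_gt0.
have [|x _|D _ cD] := cX X setT (fun x : X => [set y | mdist x y < e / 2]).
- by move=> x _; exact: open_mdist_ball.
- by exists x => //=; rewrite mdistxx.
pose s : seq X := finmap.enum_fset D.
exists (size s)%:R, 'I_(size s), (fun i : 'I_(size s) => [set y | mdist (nth point s i) y < e / 2]); split.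
- by rewrite card_ord.
- by move=> i; exact: open_mdist_ball.
- move=> i y z /= yi zi [|//] _ /=.
  apply: (le_lt_trans (metric_triangle _ (nth point s i) _)).
  by rewrite metric_sym [ltRHS]splitr ltrD.
- move=> y _; have [x /= xD xy] := cD y I.
  by move: (xD : x \in s); rewrite -index_mem => xi; exists (Ordinal xi) => //=; rewrite nth_index.
Qed.

End HeavyBalls.

(** * Counting orbits by greedy blocks *)

Section GreedyBlocks.
Context {R : realType} {X : pointedMetricType R} (T : X -> X) (d : R).
Context (contT : continuous T).

Lemma visitsS x (B : set X) n :
  @visits _ (borelType X) T x B n.+1 = ((x \in B) + @visits _ (borelType X) T (T x) B n)%N.
Proof.
rewrite /visits big_nat_recl//=; congr addn.
by apply: eq_bigr => i _; rewrite -iterSr.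
Qed.

Lemma visitsD x (B : set X) n m :
  @visits _ (borelType X) T x B (n + m)%N =
  (@visits _ (borelType X) T x B n + @visits _ (borelType X) T (iter n T x) B m)%N.
Proof.
elim: n x => [|n IH] x; first by rewrite add0n {2}/visits big_geq.
by rewrite addSn !visitsS IH addnA -iterSr.
Qed.

(** [D n] stands for the points at which a block of length [n.+1] may start, and
    [c n] for the number of sets that describe such a block.  An orbit segment
    is read from its start: at a bad point one step is made, described by one
    of [K] sets; otherwise a whole block is skipped.  The cost
    lam ^ L * kap ^ b is designed to be preserved by this recursion: [lam] pays
    for time and [kap] for each of the at most [b] bad times, and the hypotheses
    on [K] and on the sum of the [c n / lam ^+ n.+1] say that the bad step and
    all the choices of a block use up at most half of it each.  A uniform weight avoids any count of the possible
    positions of the blocks.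

    Segments have length [L - M.+1], so that [L] stays nonnegative when the last
    block overruns by at most [M.+1]. *)
Lemma coverable_greedy (m M : nat) (D : nat -> set X) (c : nat -> R) (K lam kap : R) :
  let bad := ~` \bigcup_(n in [set n | (m <= n <= M)%N]) D n in
  1 <= lam -> 1 <= kap -> 2 * K <= lam * kap ->
  coverable T d 1 setT K ->
  (forall n, (m <= n <= M)%N -> coverable T d n.+1 (D n) (c n)) ->
  \sum_(m <= n < M.+1) c n / lam ^+ n.+1 <= 2^-1 ->
  forall L b, coverable T d (L - M.+1) 
     [set x | (@visits _ (borelType X) T x bad (L - M.+1) <= b)%N]
     (lam ^+ L * kap ^+ b).
Proof.
move=> bad lam1 kap1 Kle covK covD csum; elim/ltn_ind => L IH b.
have lam0 : 0 < lam by exact: lt_le_trans lam1.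
have kap0 : 0 < kap by exact: lt_le_trans kap1.
have lk0 i j : 0 <= lam ^+ i * kap ^+ j by rewrite mulr_ge0 ?exprn_ge0// ltW.
have [LM|ML] := leqP L M.+1.
  rewrite (eqP LM); apply: coverable0.
  by rewrite -[leLHS]mulr1 ler_pM// exprn_ege1.
pose S L' b' := [set x | (@visits _ (borelType X) T x bad (L' - M.+1) <= b')%N].
(* First step at a bad time; for b = 0 there is no such point. *)
have Sbad : coverable T d (L - M.+1) (S L b `&` bad) (2^-1 * (lam ^+ L * kap ^+ b)).
  case: b => [|b].
    rewrite (_ : _ `&` _ = set0); last first.
      rewrite -subset0 => x [+ xbad]; rewrite /S /=.
      rewrite (_ : (L - M.+1 = (L.-1 - M.+1).+1)%N); last lia.
      by rewrite visitsS (mem_set xbad).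
    by apply: coverable_set0; rewrite mulr_ge0.
  apply: (coverable_le _ _ (coverable_concat contT _ covK (IH L.-1 _ b))) => //.
  - move=> x [+ xbad]; rewrite /S /= => xS; split => //=; move: xS.
    rewrite (_ : (L - M.+1 = (L.-1 - M.+1).+1)%N); last lia.
    by rewrite visitsS (mem_set xbad).
  - rewrite -[in leRHS](prednK (n := L)); last by lia.
    rewrite !exprS [leRHS](_ : _ = (2^-1 * (lam * kap)) * (lam ^+ L.-1 * kap ^+ b)); last by ring.
    by rewrite ler_wpM2r//; lra.
  - by lia.
  - by lia.
(* First step along a block of length n.+1. *)
have Sblock n : (m <= n <= M)%N ->
    coverable T d (L - M.+1) (S L b `&` D n) (c n * (lam ^+ (L - n.+1) * kap ^+ b)).
  move=> mnM.
  apply: (coverable_le _ _ (coverable_concat contT _ (covD n mnM) (IH (L - n.+1)%N _ b))) => //.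
  - move=> x [+ xD]; rewrite /S /= => xS; split => //=; apply: leq_trans xS.
    have [h|h] := leqP (L - M.+1) n.+1.
      rewrite (_ : (L - n.+1 - M.+1 = 0)%N); last lia.
      by rewrite {1}/visits big_geq.
    rewrite (_ : (L - M.+1 = n.+1 + (L - n.+1 - M.+1))%N); last lia.
    by rewrite visitsD leq_addl.
  - by lia.
  - by lia.
pose S' (j : 'I_M.+1) := if (m <= j)%N then S L b `&` D j else set0.
pose c' (j : 'I_M.+1) := if (m <= j)%N then c j * (lam ^+ (L - j.+1) * kap ^+ b) else 0.
have Sblocks : coverable T d (L - M.+1) (\bigcup_j S' j) (\sum_j c' j).
  apply: coverable_bigcup => j; rewrite /S' /c'; case: ifP => mj.
    by apply: Sblock; rewrite mj -ltnS ltn_ord.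
  exact: coverable_set0.
apply: (coverable_le _ _ (coverableU Sbad Sblocks)).
  move=> x Sx; have [xb|/contrapT [n /= nmM Dx]] := pselect (bad x); [by left|right].
  have nM : (n < M.+1)%N by move: nmM => /andP[].
  by exists (Ordinal nM) => //; rewrite /S' /=; move: nmM => /andP[-> _].
have e2 : \sum_j c' j <= 2^-1 * (lam ^+ L * kap ^+ b).
  rewrite /c' -big_mkcond/= -(big_geq_mkord _ _ xpredT (fun j => c j * (lam ^+ (L - j.+1) * kap ^+ b))).
  rewrite (eq_big_nat _ _ (F2 := fun j => c j / lam ^+ j.+1 * (lam ^+ L * kap ^+ b))).
    by rewrite -mulr_suml ler_wpM2r.
  move=> j /andP[_ jM]; rewrite expfB; last by lia.
  by rewrite -!mulrA; congr (_ * _); rewrite mulrCA.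
by rewrite [leRHS](_ : _ = 2^-1 * (lam ^+ L * kap ^+ b) + 2^-1 * (lam ^+ L * kap ^+ b)) ?lerD//; lra.
Qed.

End GreedyBlocks.

(** * Points with slowly decaying balls *)

Lemma geometric_tail_le (R : realType) (q : R) (m M : nat) : 0 <= q < 1 ->
  (1 - q) * \sum_(m <= n < M) q ^+ n <= q ^+ m.
Proof.
move=> /andP[q0 q1]; have [Mm|mM] := leqP M m.
  by rewrite big_geq// mulr0 exprn_ge0.
rewrite mulr_sumr (eq_bigr (fun n => - q ^+ n.+1 - - q ^+ n)); last first.
  by move=> n _; rewrite exprS; ring.
rewrite (telescope_sumr (fun n => - q ^+ n)) 1?ltnW//.
by have := exprn_ge0 M q0; lra.
Qed.

Lemma exists_expr_le (R : realType) (q t : R) : 0 <= q < 1 -> 0 < t ->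
  exists n, q ^+ n <= t.
Proof.
move=> /andP[q0 q1] t0.
have /cvgrPdist_le/(_ t t0)[n _ /(_ n (leqnn n))] : q ^+ n @[n --> \oo] --> 0.
  by apply: cvg_expr; rewrite ger0_norm.
by rewrite /= sub0r normrN ger0_norm ?exprn_ge0// => ?; exists n.
Qed.

Section SlowPoints.
Context {R : realType} {X : pointedMetricType R} (T : X -> X).
Context (mu : probability (borelType X) R).
Context (contT : continuous T).
Context (invmu : invariant_measure mu T).
Context (compactX : compact [set: X]).
Implicit Types (x y : X) (n : nat) (e a b : R).

(** The set where the liminf of -log mu(B_n(x,e)) / n is at most [a], written
    with countable operations on open sets.  The slack 1/(k+1) makes it forward
    invariant, as it absorbs the loss of one unit of length under [T]. *)
Definition slow e a : set X :=
  \bigcap_k \bigcap_m \bigcup_(n in [set n | (m <= n)%N])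
    heavy T mu n e (expR (- ((a + k.+1%:R^-1) * n%:R))).

Lemma measurable_slow e a : 0 < e -> measurable (slow e a : set (borelType X)).
Proof.
move=> e0; apply: bigcap_measurable => // k _; apply: bigcap_measurable => // m _.
by apply: bigcup_measurable => n _; exact: measurable_heavy.
Qed.

(** The slack 1/(2k+2) at [x] is turned into 1/(k+1) at [T x]; the other half
    compensates the shift from [n.+1] to [n] once [n] is large. *)
Lemma slow_forward e a : 0 < e -> slow e a `<=` T @^-1` slow e a.
Proof.
move=> e0 x sx k _ m _; set s := k.+1%:R^-1.
have s0 : 0 < s by rewrite invr_gt0.
have sE : (k.*2.+2)%:R^-1 = s / 2 :> R.
  by rewrite (_ : k.*2.+2 = k.+1 * 2)%N ?natrM ?invfM//; lia.
pose m' := (Num.truncn ((a + s / 2) / (s / 2))).+1.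
have [[//|n] mn] := sx k.*2.+1 I (maxn m m').+1 I.
rewrite /heavy /= sE => hx; exists n => /=; first by move: mn => /=; lia.
apply: (@lt_le_trans _ _ (pr mu (bowen_ball T n.+1 x e))).
  apply: le_lt_trans hx; rewrite ler_expR lerN2 -[n.+1%:R]natr1 mulrDr mulr1.
  have : (a + s / 2) <= s / 2 * n%:R.
    rewrite [leRHS]mulrC -ler_pdivrMr ?divr_gt0//.
    apply: le_trans (ltW (truncnS_gt _)) _.
    rewrite ler_nat -/m'; move: mn => /=; lia.
  lra.
rewrite -[leRHS](pr_iter (measurable_preimage_borel contT) invmu 1); last exact: measurable_bowen_ball.
apply: pr_le; last exact: (bowen_ball_step e0).
- exact: measurable_bowen_ball.
- by apply: measurable_preimage_borel => //; exact: measurable_bowen_ball.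
Qed.

Lemma slow_iter e a x i : 0 < e -> slow e a x -> slow e a (iter i T x).
Proof. by move=> e0 sx; elim: i => // i IH; exact: slow_forward. Qed.

(** The exceptional set is chosen before the length [N]: outside of it, the
    frequency of bad times is small at every length. *)
Theorem slow_cover e a b th : 0 < e -> 0 <= a -> a < b -> 0 < th ->
  exists G : set (borelType X), [/\ measurable G, pr mu (slow e a `\` G) <= th &
    exists C : R, forall N, coverable T (4 * e) N G (C * expR (b * N%:R))].
Proof.
move=> e0 a0 ab th0.
(* A quarter g of the gap pays in turn for the slack of slow, for the margin
   that makes the costs of the blocks summable, and for the bad times. *)
pose g := (b - a) / 4; have g0 : 0 < g by rewrite divr_gt0// subr_gt0.
have [k kg] := exists_natSinv_le g0.
pose a1 := a + k.+1%:R^-1.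
have a1gt0 : 0 < a1 by rewrite ltr_wpDl// invr_gt0.
have a1g : a1 <= a + g by rewrite lerD2l.
have e40 : 0 < 4 * e by rewrite mulr_gt0.
have [K covK] := coverable1 T e40 compactX.
have K0 : 0 <= K by case: covK => I [A [IK _ _ _]]; exact: le_trans IK.
pose k0 := 2 * K + 1; have k00 : 0 < k0 by rewrite /k0; lra.
(* A bad time costs kap = exp k0, so eta N of them cost at most exp (g N). *)
pose eta := g / k0; have eta0 : 0 < eta by rewrite divr_gt0.
pose lam := expR (a1 + g); pose kap := expR k0.
have lam1 : 1 <= lam by rewrite -expR0 ler_expR addr_ge0 ?ltW.
have kap1 : 1 <= kap by rewrite -expR0 ler_expR ltW.
have Klk : 2 * K <= lam * kap.
  apply: (@le_trans _ _ (1 * kap)); last by rewrite ler_wpM2r// ltW// expR_gt0.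
  by rewrite mul1r; apply: le_trans (expR_ge1Dx _); rewrite /k0; lra.
pose q := expR (- g).
have q01 : 0 <= q < 1 by rewrite ltW ?expR_gt0//= expR_lt1 oppr_lt0.
(* Short blocks are discarded so that the tail of the geometric series of their
   relative costs is at most 1/2. *)
have [m qm] : exists m, q ^+ m <= (1 - q) / 2.
  by apply: exists_expr_le => //; case/andP: q01; lra.
pose D n := heavy T mu n e (expR (- (a1 * n%:R))).
pose good M := \bigcup_(n in [set n | (m <= n <= M)%N]) D n.
have mD n : measurable (D n : set (borelType X)) by exact: measurable_heavy.
have mgood M : measurable (good M : set (borelType X)) by exact: bigcup_measurable.
have mslow := measurable_slow a e0.
have [M x [n /= /andP[mn nM] Dn]|x sx|M hM] := pr_approx_bigcup mu mslow mgood _ _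
  (mulr_gt0 eta0 th0).
- by exists n => //=; rewrite mn leqW.
- by have [n mn Dn] := sx k I m I; exists n => //; exists n => //=; rewrite mn leqnn.
pose B : set (borelType X) := slow e a `\` good M.
have mB : measurable B by exact: measurableD.
have mT := measurable_preimage_borel contT.
have mrare := measurable_rarely_visiting mT eta mB.
pose rare := @rarely_visiting _ (borelType X) R T B eta.
exists (slow e a `&` rare); split; first exact: measurableI.
  have h : pr mu (~` rare) <= th.
    rewrite -(ler_pM2l eta0); apply: le_trans hM.
    exact: (maximal_ergodic_inequality mT invmu mB (ltW eta0)).
  apply: le_trans h; apply: pr_le.
  - by apply: measurableD => //; exact: measurableI.
  - exact: measurableC.
  - by move=> x [sx h] rx; apply: h.
exists (lam ^+ M.+1) => N.
have := coverable_greedy contT (m := m) (M := M) (D := D)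
  (c := fun n => (expR (- (a1 * n%:R)))^-1) lam1 kap1 Klk covK.
move=> /(_ _ _ (N + M.+1)%N (Num.truncn (eta * N%:R))).
rewrite addnK => H.
apply: (coverable_le _ _ (H _ _)).
- move=> x [sx rx] /=; rewrite truncn_ge_nat; last by rewrite mulr_ge0// ltW.
  apply: le_trans (rx N); rewrite ler_nat; apply: leq_sum => i _.
  have [h|//] := boolP (iter i T x \in ~` _).
  rewrite (_ : (iter i T x \in B) = true)//; apply/mem_set; split; first exact: slow_iter.
  by move: h; rewrite inE.
- rewrite exprD mulrAC mulrC ler_wpM2l ?exprn_ge0 ?expR_ge0//.
  rewrite /lam /kap -!expRM_natr -expRD ler_expR.
  set t := Num.truncn _.
  have tN : k0 * t%:R <= g * N%:R.
    rewrite (_ : g = k0 * eta); last by rewrite /eta mulrCA divff ?gt_eqF// mulr1.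
    by rewrite -mulrA ler_wpM2l ?(ltW k00)// truncn_le mulr_ge0// ltW.
  have : (a1 + g) * N%:R <= (a + 2 * g) * N%:R.
    by rewrite ler_wpM2r//; lra.
  rewrite (_ : b = a + 4 * g); last by rewrite /g; lra.
  have : 0 <= g * N%:R by rewrite mulr_ge0// ltW.
  lra.
- by move=> n _; apply: coverable_heavy => //; exact: expR_gt0.
- apply: (@le_trans _ _ (\sum_(m <= n < M.+1) q ^+ n)).
    apply: ler_sum => n _; rewrite /lam /q -expRN opprK -!expRM_natr -expRB ler_expR.
    rewrite -[n.+1%:R]natr1.
    have : 0 <= a1 + g by rewrite addr_ge0 ?ltW.
    lra.
  case/andP: (q01) => q0 q1; rewrite -(ler_pM2l (x := 1 - q)) ?subr_gt0//.
  exact: le_trans (geometric_tail_le m M.+1 q01) qm.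
Qed.

End SlowPoints.

(** * Existence of the local entropy *)

Section LimsupLiminf.
Context {R : realType}.
Implicit Types (u v : (\bar R)^nat) (c : \bar R).

Lemma limn_esup_le u N c : (forall n, (N <= n)%N -> (u n <= c)%E) ->
  (limn_esup u <= c)%E.
Proof.
move=> h; rewrite /limn_esup limf_esupE.
apply: (@le_trans _ _ (ereal_sup [set u n | n in [set n | (N <= n)%N]])).
  apply: ereal_inf_lbound; exists [set n | (N <= n)%N] => //.
  by exists N.
by apply: ge_ereal_sup => _ [n /= Nn <-]; exact: h.
Qed.

Lemma le_limn_einf u N c : (forall n, (N <= n)%N -> (c <= u n)%E) ->
  (c <= limn_einf u)%E.
Proof.
move=> h; rewrite /limn_einf leeNr; apply: (@limn_esup_le _ N) => n Nn.
by rewrite leeN2; exact: h.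
Qed.

Lemma lee_limn_esup u v : (forall n, (u n <= v n)%E) ->
  (limn_esup u <= limn_esup v)%E.
Proof.
move=> uv; rewrite /limn_esup !limf_esupE.
apply: le_ereal_inf_tmp => _ [V FV <-].
apply: (@le_trans _ _ (ereal_sup [set u n | n in V])).
  by apply: ereal_inf_lbound; exists V.
apply: ge_ereal_sup => _ [n Vn <-]; apply: (le_trans (uv n)).
by apply: ereal_sup_ubound; exists n.
Qed.

Lemma lee_limn_einf u v : (forall n, (u n <= v n)%E) ->
  (limn_einf u <= limn_einf v)%E.
Proof. by move=> uv; rewrite /limn_einf leeN2 lee_limn_esup// => n; rewrite leeN2. Qed.

Lemma limn_einf_lt_frequently u c : (limn_einf u < c)%E ->
  forall m, exists2 n, (m <= n)%N & (u n < c)%E.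
Proof.
move=> uc m; apply: contrapT => h; move: uc; apply/negP; rewrite -leNgt.
apply: (@le_limn_einf _ m) => n mn; rewrite leNgt; apply/negP => unc.
by apply: h; exists n.
Qed.

End LimsupLiminf.

Lemma two_rats_between (R : realType) (u v : \bar R) : (0 <= u)%E -> (u < v)%E ->
  exists p q : rat, [/\ (u < (ratr p)%:E)%E, 0 <= ratr p :> R, ratr p < ratr q :> R &
    ((ratr q)%:E < v)%E].
Proof.
case: u => [r| |] //; last by move=> _; rewrite ltNge leey.
rewrite lee_fin => r0 rv.
have [s rs sv] : exists2 s, r < s & (s%:E <= v)%E.
  case: v rv => [s| |]//; first by rewrite lte_fin => ?; exists s.
  by move=> _; exists (r + 1); rewrite ?ltrDl// leey.
have [p] := rat_in_itvoo rs; rewrite in_itv/= => /andP[rp ps].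
have [q] := rat_in_itvoo ps; rewrite in_itv/= => /andP[pq qs].
exists p, q; split => //; rewrite ?lte_fin//; first by rewrite (le_trans r0)// ltW.
by apply: lt_le_trans sv; rewrite lte_fin.
Qed.

Section LocalEntropy.
Context {R : realType} {X : pointedMetricType R} (T : X -> X).
Context (mu : probability (borelType X) R).
Context (contT : continuous T).
Implicit Types (x y : X) (n : nat) (e a b c : R).

Notation ball_pr n x e := (pr mu (bowen_ball T n x e)).
Notation rate x e := (bowen_ball_rate mu T x e).

Lemma rate_le x e n c : 0 < e ->
  (rate x e n.+1 <= c%:E)%E = (expR (- (c * n.+1%:R)) <= ball_pr n.+1 x e).
Proof.
move=> e0; rewrite /bowen_ball_rate inver/= gt_eqF//.
rewrite lee_pdivrMr// -EFinM leeNl -EFinN.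
rewrite [mu _](prE mu (measurable_bowen_ball contT n.+1 x e0)).
have [p0|p0] := ltP 0 (ball_pr n.+1 x e).
  by rewrite lne_EFin// lee_fin -[in RHS](lnK p0) ler_expR.
rewrite le0_lneNy ?lee_fin//; apply/esym/negbTE.
by rewrite -ltNge (le_lt_trans p0)// expR_gt0.
Qed.

Lemma rate_ge0 x e n : 0 < e -> (0 <= rate x e n)%E.
Proof.
move=> e0; rewrite /bowen_ball_rate mule_ge0//.
  by rewrite leeNr oppe0 lne_le0 probability_le1//; exact: measurable_bowen_ball.
by rewrite inve_ge0 lee_fin.
Qed.

Lemma rate_noninc x e f n : 0 < e -> e <= f -> (rate x f n <= rate x e n)%E.
Proof.
move=> e0 ef; have f0 := lt_le_trans e0 ef.
rewrite /bowen_ball_rate lee_wpmul2r//; first by rewrite inve_ge0 lee_fin.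
rewrite leeN2 lee_lne ?in_itv/= ?leey ?andbT//.
apply: le_measure; rewrite ?inE; try exact: measurable_bowen_ball.
exact: bowen_ball_le.
Qed.

Lemma lower_local_entropyE x : lower_local_entropy mu T x =
    ereal_sup [set limn_einf (rate x e) | e in [set e | 0 < e]].
Proof.
apply: cvg_lim => //.
have := @nonincreasing_at_right_cvge R (fun e => limn_einf (rate x e)) 0 (BInfty _ false) isT.
rewrite set_itvE; apply => e f; rewrite !in_itv/= !andbT => e0 f0 ef.
by apply: lee_limn_einf => n; exact: rate_noninc.
Qed.

Lemma upper_local_entropyE x : upper_local_entropy mu T x =
    ereal_sup [set limn_esup (rate x e) | e in [set e | 0 < e]].
Proof.
apply: cvg_lim => //.
have := @nonincreasing_at_right_cvge R (fun e => limn_esup (rate x e)) 0 (BInfty _ false) isT.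
rewrite set_itvE; apply => e f; rewrite !in_itv/= !andbT => e0 f0 ef.
by apply: lee_limn_esup => n; exact: rate_noninc.
Qed.

Lemma einf_lt_slow x e a : 0 < e -> (limn_einf (rate x e) < a%:E)%E ->
  slow T mu e a x.
Proof.
move=> e0 /limn_einf_lt_frequently h k _ m _.
have [[//|n] mn /ltW] := h m.+1; rewrite rate_le// => hn.
exists n.+1; first exact: ltnW.
apply: lt_le_trans hn; rewrite ltr_expR ltrN2 ltr_pM2r//.
by rewrite ltrDl invr_gt0.
Qed.

Lemma esup_le x e b N : 0 < e ->
  (forall n, (N <= n)%N -> expR (- (b * n%:R)) <= ball_pr n x e) ->
  (limn_esup (rate x e) <= b%:E)%E.
Proof.
move=> e0 h; apply: (@limn_esup_le _ _ N.+1) => -[//|n] Nn.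
by rewrite rate_le//; apply: h; exact: ltnW.
Qed.

Context (invmu : invariant_measure mu T).
Context (compactX : compact [set: X]).

(** Borel-Cantelli against the covers of [slow_cover]: the covering sets lighter
    than exp(-b n) have a summable total measure, and a covering set that
    contains [x] lies in the ball of radius 4e around [x]. *)
Theorem slow_ball_lower_bound e a b : 0 < e -> 0 <= a -> a < b ->
  {ae mu, forall x : X, slow T mu e a x ->
    exists N, forall n, (N <= n)%N -> expR (- (b * n%:R)) <= ball_pr n x (4 * e)}.
Proof.
move=> e0 a0 ab; apply: negligible_small => th th0.
pose g := (b - a) / 2; have g0 : 0 < g by rewrite divr_gt0// subr_gt0.
have ab' : a < a + g by rewrite ltrDl.
have [G [mG pG [C hC]]] := slow_cover contT invmu compactX e0 a0 ab' th0.
(* B_n involves the times 0, ..., n, hence covers of length n.+1. *)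
pose cov n := hC n.+1.
have h n := svalP (cid (svalP (cid (cov n)))).
set I := fun n => sval (cid (cov n)) in h.
set A : forall n, I n -> set X := fun n => sval (cid (svalP (cid (cov n)))) in h.
pose light n (i : I n) := pr mu (A n i) < expR (- (b * n%:R)).
pose bad n : set (borelType X) := \big[setU/set0]_(i | light n i) A n i.
have mA n i : measurable (A n i : set (borelType X)).
  by apply: open_measurable_borel; have [_ oA _ _] := h n; exact: oA.
have mbad n : measurable (bad n) by apply: bigsetU_measurable => i _; exact: mA.
pose q := expR (- g).
have q01 : 0 <= q < 1 by rewrite ltW ?expR_gt0//= expR_lt1 oppr_lt0.
have C0 : 0 <= C.
  have [I0 _ _ _] := h 0%N; have := le_trans (ler0n R #|I 0%N|) I0.
  by rewrite pmulr_lge0// expR_gt0.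
pose C' := C * expR (a + g).
have badle n : pr mu (bad n) <= C' * q ^+ n.
  apply: (le_trans (pr_bigsetU_le mu _ _ _)); first exact: mA.
  apply: (@le_trans _ _ (\sum_(i : I n) expR (- (b * n%:R)))).
    rewrite big_mkcond/=; apply: ler_sum => i _; case: ifP => [/ltW//|_].
    by rewrite ltW// expR_gt0.
  rewrite sumr_const -[leLHS]mulr_natl; have [In _ _ _] := h n.
  apply: (@le_trans _ _ (C * expR ((a + g) * n.+1%:R) * expR (- (b * n%:R)))).
    by rewrite ler_wpM2r ?expR_ge0.
  rewrite /C' -!mulrA ler_wpM2l// /q -expRM_natr -!expRD ler_expR -[n.+1%:R]natr1 /g.
  lra.
have lim0 : mu (lim_sup_set bad) = 0.
  apply: lim_sup_set_cvg0 => //.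
  apply: (@le_lt_trans _ _ (C' / (1 - q))%:E); last exact: ltry.
  apply: lime_le; first exact: is_cvg_nneseries.
  apply: nearW => n.
  rewrite (eq_bigr (fun i => (pr mu (bad i))%:E)); last by move=> i _; exact: (prE mu (mbad i)).
  rewrite sumEFin lee_fin; case/andP: (q01) => q0 q1.
  apply: (@le_trans _ _ (\sum_(0 <= i < n) C' * q ^+ i)).
    by apply: ler_sum => i _; exact: badle.
  rewrite -mulr_sumr ler_wpM2l ?mulr_ge0 ?expR_ge0//.
  by rewrite -[leRHS]mul1r ler_pdivlMr ?subr_gt0// mulrC (geometric_tail_le 0 n q01).
have mls : measurable (lim_sup_set bad).
  by apply: bigcap_measurable => // k _; exact: bigcup_measurable.
have mslow := measurable_slow mu contT a e0.
have mD : measurable (slow T mu e a `\` G : set (borelType X)) by exact: measurableD.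
exists ((slow T mu e a `\` G) `|` lim_sup_set bad); first exact: measurableU.
split; last first.
  apply: (le_trans (prU_le _ _ _)) => //.
  by rewrite [X in _ + X](_ : _ = 0) ?addr0// /pr lim0.
move=> x /= /not_implyP[sx nx].
have [Gx|] := pselect (G x); last by left.
right => k _; apply: contrapT => nk; apply: nx; exists k => n kn.
have [_ _ sA /(_ _ Gx)[i _ Ax]] := h n.
have [il|il] := ltP (pr mu (A n i)) (expR (- (b * n%:R))).
  exfalso; apply: nk; exists n => //=.
  by rewrite /bad (bigD1 i il); left.
apply: (le_trans il); apply: pr_le => //.
  by apply: measurable_bowen_ball => //; rewrite mulr_gt0.
move=> y Ay; apply/bowen_ballP; first by rewrite mulr_gt0.
by move=> j jn; apply: (sA i).
Qed.

(** If the liminf at radius e were below the limsup at radius 4e, two rationals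
    would separate them and contradict [slow_ball_lower_bound]; rational
    exponents and radii 1/(j+1) leave countably many null sets. *)
Theorem local_entropy_exists :
  {ae mu, forall x : X, lower_local_entropy mu T x = upper_local_entropy mu T x}.
Proof.
pose e_ (j : nat) : R := j.+1%:R^-1.
pose a_ (k : nat) : R := `|ratr (odflt 0 (unpickle k) : rat)|.
have aeP : {ae mu, forall x : X, forall j k l : nat, a_ k < a_ l -> slow T mu (e_ j) (a_ k) x ->
    exists N, forall n, (N <= n)%N -> expR (- (a_ l * n%:R)) <= ball_pr n x (4 * e_ j)}.
  apply: ae_foralln => j; apply: ae_foralln => k; apply: ae_foralln => l.
  have [kl|kl] := ltP (a_ k) (a_ l); last first.
    exact: aeW.
  have e0 : 0 < e_ j by rewrite invr_gt0.
  have := slow_ball_lower_bound e0 (normr_ge0 _) kl.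
  by apply: ae_imp => x h _.
apply: ae_imp aeP => x h.
rewrite lower_local_entropyE upper_local_entropyE.
apply/eqP; rewrite eq_le; apply/andP; split.
  apply: ge_ereal_sup => _ [e e0 <-].
  apply: le_trans (limn_einf_sup _) _.
  by apply: ereal_sup_ubound; exists e.
apply: ge_ereal_sup => _ [e /= e0 <-].
have [j je] := @exists_natSinv_le R (e / 4) (divr_gt0 e0 (ltr0Sn _ 3)).
have ej0 : 0 < e_ j by rewrite invr_gt0.
have e4j : 4 * e_ j <= e by rewrite mulrC -ler_pdivlMr.
apply: (@le_trans _ _ (limn_einf (rate x (e_ j)))); last first.
  by apply: ereal_sup_ubound; exists (e_ j).
apply: (@le_trans _ _ (limn_esup (rate x (4 * e_ j)))).
  by apply: lee_limn_esup => n; apply: rate_noninc => //; rewrite mulr_gt0.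
rewrite leNgt; apply/negP => lt.
have ge0 : (0 <= limn_einf (rate x (e_ j)))%E.
  by apply: (@le_limn_einf _ _ 0%N) => n _; exact: rate_ge0.
have [p [q [up p0 pq qv]]] := two_rats_between ge0 lt.
have aE r : 0 <= ratr r :> R -> a_ (pickle r) = ratr r.
  by rewrite /a_ pickleK/= => /ger0_norm.
have [||N hN] := h j (pickle p) (pickle q).
- by rewrite !aE// (le_trans p0)// ltW.
- by rewrite aE//; exact: einf_lt_slow.
move: qv; apply/negP; rewrite -leNgt; apply: (@esup_le _ _ _ N); first by rewrite mulr_gt0.
by move=> n Nn; have := hN n Nn; rewrite aE// (le_trans p0)// ltW.
Qed.

End LocalEntropy.

(** * Restricted rates and decay of balls *)

Lemma lt_limn_einf (R : realType) (u : (\bar R)^nat) (c : \bar R) :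
  (c < limn_einf u)%E -> exists N, forall n, (N <= n)%N -> (c < u n)%E.
Proof.
rewrite /limn_einf lteNr /limn_esup limf_esupE => /ereal_inf_lt[_ [V [N _ NV] <-] h].
exists N => n Nn; rewrite -lteN2; apply: le_lt_trans h.
by apply: ereal_sup_ubound; exists n => //; exact: NV.
Qed.

Section RestrictedRate.
Context {R : realType} {X : pointedMetricType R} (T : X -> X).
Context (mu : probability (borelType X) R).
Context (contT : continuous T).
Implicit Types (x y : X) (n : nat) (e a b c d : R).

Notation ball_pr n x e := (pr mu (bowen_ball T n x e)).
Notation rate x e := (bowen_ball_rate mu T x e).

Definition far n x d : set (borelType X) := [set y | d < mdist (iter n T x) (iter n T y)].

Lemma measurable_far n x d : measurable (far n x d).
Proof.
apply: open_measurable_borel.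
rewrite (_ : far n x d = iter n T @^-1` [set y | d < mdist (iter n T x) y])//.
apply: open_preimage_iter => //; rewrite openE => y /= xy.
apply/nbhs_ballP; exists (mdist (iter n T x) y - d); first by rewrite /= subr_gt0.
move=> z; rewrite ballEmdist /= => yz.
have := metric_triangle (iter n T x) z y; rewrite (metric_sym z y) => h.
lra.
Qed.

Lemma rate_ge x e n c : 0 < e ->
  (c%:E <= rate x e n.+1)%E = (ball_pr n.+1 x e <= expR (- (c * n.+1%:R))).
Proof.
move=> e0; rewrite /bowen_ball_rate inver/= gt_eqF//.
rewrite lee_pdivlMr// -EFinM leeNr -EFinN.
rewrite [mu _](prE mu (measurable_bowen_ball contT n.+1 x e0)).
have [p0|p0] := ltP 0 (ball_pr n.+1 x e).
  by rewrite lne_EFin// lee_fin -[in RHS](lnK p0) ler_expR.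
by rewrite le0_lneNy ?lee_fin// leNye (le_trans p0)// expR_ge0.
Qed.

(** Test the rate on V = B_k(x,d): no point of it can be [d]-far from [x] at a
    time up to [k], so the time provided exceeds [k]. *)
Lemma asymptotic_rate_decay x d a : 0 < d -> asymptotic_rate mu T x d a ->
  forall k, ball_pr k x d <= expR (- (a^-1 * k.+1%:R)).
Proof.
move=> d0 [a0 h] k.
have mB : measurable (bowen_ball T k x d : set (borelType X)) by exact: measurable_bowen_ball.
have [p0|p0] := ltP 0 (ball_pr k x d); last by rewrite (le_trans p0)// expR_ge0.
have [|n [na]] := h _ mB; first by rewrite prE// lte_fin.
have [nk|kn _] := leqP n k.
  rewrite (_ : _ `&` _ = set0) ?measure0 ?ltxx// -subset0 => y [/bowen_ballP h' /=].
  by rewrite ltNge ltW// h'.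
move: na; rewrite prE// lne_EFin// -EFinM -EFinN lee_fin => na.
rewrite -[leLHS](lnK p0) ler_expR -(ler_pM2l a0) mulrN mulrA divff ?gt_eqF// mul1r lerNr.
by apply: le_trans na; rewrite ler_nat.
Qed.

(** Suppose [V] defeats the rate [a], and let m = floor(-a log mu(V)).  Up to a
    null set [V] lies in B_m(x,e), so mu(V) <= exp(-c m); as c a > 1, this
    bounds m.  The bounded values of m mean that mu(V) is not small, which is
    excluded by taking [d] small: [V] also lies in a [d]-ball around [x]. *)
Lemma decay_asymptotic_rate x e c a N : 0 < e -> 0 < c -> 1 < c * a ->
  (forall n, (N <= n)%N -> ball_pr n x e <= expR (- (c * n%:R))) ->
  exists2 d, 0 < d & asymptotic_rate mu T x d a.
Proof.
move=> e0 c0 ca h.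
have a0 : 0 < a by rewrite -(pmulr_rgt0 _ c0); lra.
have ca0 : 0 < c * a - 1 by rewrite subr_gt0.
(* n1 bounds the values of m; B_n2(x,e) is lighter than exp (- n1.+1 / a), and d
   is chosen so that the d-ball around x lies in B_n2(x,e). *)
pose n1 := maxn N (Num.truncn (a * c / (c * a - 1))).+1.
pose n2 := maxn N (Num.truncn (n1.+1%:R / a / c)).+1.
have n2P : expR (- (c * n2%:R)) < expR (- (n1.+1%:R / a)).
  rewrite ltr_expR ltrN2 [ltRHS]mulrC -ltr_pdivrMr//.
  by apply: (lt_le_trans (truncnS_gt _)); rewrite ler_nat leq_maxr.
have /nbhs_ballP[r /= r0 hr] : nbhs x (bowen_ball T n2 x e).
  by apply: open_nbhs_nbhs; split; [exact: open_bowen_ball|exact: bowen_ball_center].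
pose d := Num.min r e / 2.
have d0 : 0 < d by rewrite divr_gt0// lt_min r0.
have dr : d < r.
  by rewrite /d ltr_pdivrMr// (le_lt_trans (_ : _ <= r))// ?ge_min ?lexx// ltr_pMr// ltr1n.
have de : d < e.
  by rewrite /d ltr_pdivrMr// (le_lt_trans (_ : _ <= e))// ?ge_min ?lexx ?orbT// ltr_pMr// ltr1n.
exists d => //; split => // V mV V0; apply: contrapT => hV.
have v0 : 0 < pr mu V by rewrite -lte_fin -prE.
pose L := - ln (pr mu V).
have L0 : 0 <= a * L.
  by apply: mulr_ge0; [exact: ltW|rewrite oppr_ge0 ln_le0// pr_le1].
pose m := Num.truncn (a * L).
have mL : m%:R <= a * L by rewrite truncn_le.
have Lm : a * L < m%:R + 1 by rewrite natr1 truncnS_gt.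
(* Otherwise n would be a time that V needs. *)
have null n : (n <= m)%N -> pr mu (V `&` far n x d) = 0.
  move=> nm; apply/eqP; rewrite eq_le pr_ge0 andbT leNgt; apply/negP => p0.
  have mVf : measurable (V `&` far n x d) by apply: measurableI => //; exact: measurable_far.
  apply: hV; exists n; split; last by rewrite [X in (_ < X)%E](prE mu mVf) lte_fin.
  rewrite prE// lne_EFin// -EFinM -EFinN lee_fin -mulrN.
  by apply: le_trans mL; rewrite ler_nat.
have Vle (B : set (borelType X)) : measurable B ->
    (forall y, (forall n, (n <= m)%N -> mdist (iter n T x) (iter n T y) <= d) -> B y) ->
    pr mu V <= pr mu B.
  move=> mB hB; pose F n := V `&` far n x d.
  have mF n : measurable (F n) by apply: measurableI => //; exact: measurable_far.
  have mU := @bigsetU_measurable _ (borelType X) _ (index_iota 0 m.+1) xpredT F (fun n _ => mF n).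
  apply: (@le_trans _ _ (pr mu (B `|` \big[setU/set0]_(0 <= n < m.+1) F n))).
    apply: pr_le => //; first exact: measurableU.
    move=> y Vy; have [By|nB] := pselect (B y); [by left|right].
    apply: contrapT => nF; apply: nB; apply: hB => n nm; rewrite leNgt; apply/negP => dn.
    by apply: nF; rewrite big_mkord -bigcup_mkord; exists n.
  apply: (le_trans (prU_le _ mB mU)).
  rewrite gerDl; apply: (le_trans (pr_bigsetU_le _ _ _ mF)).
  rewrite big_nat_cond big1// => n /andP[/andP[_ nm] _].
  exact: null.
have VB : pr mu V <= expR (- (c * n2%:R)).
  apply: le_trans (h _ (leq_maxl _ _)); apply: Vle; first exact: measurable_bowen_ball.
  move=> y /(_ 0%N isT) /= xy; apply: hr; rewrite ballEmdist /=.
  exact: le_lt_trans dr.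
have n1m : n1.+1%:R < a * L.
  rewrite [ltRHS]mulrC -ltr_pdivrMr// /L ltrNr.
  by rewrite -ltr_expR (lnK v0); exact: le_lt_trans n2P.
have n1lm : (n1 < m)%N by rewrite truncn_ge_nat// ltW.
have VBm : pr mu V <= expR (- (c * m%:R)).
  apply: (le_trans (Vle (bowen_ball T m x e) _ _)); first exact: measurable_bowen_ball.
    move=> y hy; apply/bowen_ballP => // n nm; exact: le_lt_trans (hy n nm) de.
  by apply: h; apply: leq_trans (ltnW n1lm); rewrite leq_maxl.
have cm : c * m%:R <= L by rewrite /L lerNr -ler_expR (lnK v0).
have n1lt : a * c / (c * a - 1) < n1%:R.
  by apply: (lt_le_trans (truncnS_gt _)); rewrite ler_nat leq_maxr.
move: n1lt; rewrite ltr_pdivrMr// => n1lt.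
have nm : n1%:R * (c * a - 1) < m%:R * (c * a - 1) by rewrite ltr_pM2r// ltr_nat.
have acm : a * (c * m%:R) <= a * L by rewrite ler_pM2l.
lra.
Qed.

Lemma asymptotic_rate_le x d d' a : d' <= d ->
  asymptotic_rate mu T x d a -> asymptotic_rate mu T x d' a.
Proof.
move=> dd' [a0 h]; split => // V mV V0; have [n [na hn]] := h V mV V0.
exists n; split => //; apply: (lt_le_trans hn); apply: le_measure; rewrite ?inE.
- by apply: measurableI => //; exact: (measurable_far n x d).
- by apply: measurableI => //; exact: (measurable_far n x d').
- by move=> y [Vy] /= dy; split => //=; exact: le_lt_trans dy.
Qed.

Lemma restricted_rateE x : restricted_rate mu T x =
  ereal_inf [set restricted_rate_at mu T x d | d in [set d | 0 < d]].
Proof.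
apply: cvg_lim => //.
have := @nondecreasing_at_right_cvge R (restricted_rate_at mu T x) 0 (BInfty _ false) isT.
rewrite set_itvE; apply => d d'; rewrite !in_itv/= !andbT => d0 d'0 dd'.
apply: ereal_inf_le_tmp.
apply: image_subset => a; exact: asymptotic_rate_le.
Qed.

(** Decay of balls bounds the rates at every radius from below, and each number
    above the inverse of the entropy is a rate at some radius. *)
Theorem restricted_rate_inv x :
  restricted_rate mu T x = ((lower_local_entropy mu T x)^-1)%E.
Proof.
have hE := lower_local_entropyE mu contT x.
set h := lower_local_entropy mu T x in hE *.
have h0 : (0 <= h)%E.
  rewrite hE; apply: (@le_trans _ _ (limn_einf (rate x 1))).
    by apply: (@le_limn_einf _ _ 0%N) => n _; exact: rate_ge0.
  by apply: ereal_sup_ubound; exists 1 => /=.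
rewrite restricted_rateE; apply/eqP; rewrite eq_le; apply/andP; split; last first.
  apply: le_ereal_inf_tmp => _ [d /= d0 <-].
  apply: le_ereal_inf_tmp => _ [a /= ad <-].
  have a0 : 0 < a by case: ad.
  have a0e : (0 <= a%:E)%E by rewrite lee_fin ltW.
  rewrite inve_ple ?inE// inver gt_eqF// hE.
  apply: (@le_trans _ _ (limn_einf (rate x d))); last first.
    by apply: ereal_sup_ubound; exists d.
  apply: (@le_limn_einf _ _ 1%N) => -[//|n] _; rewrite rate_ge//.
  apply: (le_trans (asymptotic_rate_decay d0 ad _)).
  by rewrite ler_expR lerN2 ler_pM2l ?invr_gt0// ler_nat.
rewrite leNgt; apply/negP => lt.
have hV0 : (0 <= h^-1)%E by rewrite inve_ge0.
have [p [q [hp p0 pq qi]]] := two_rats_between hV0 lt.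
set p' : R := ratr p in hp p0 pq; set q' : R := ratr q in pq qi.
have pp : 0 < p' by rewrite -lte_fin; exact: le_lt_trans hp.
have ph : ((p'^-1)%:E < h)%E.
  by move: hp; rewrite inve_plt ?inE ?lee_fin ?(ltW pp)// inver gt_eqF.
move: ph; rewrite hE => /ereal_sup_gt[_ [e /= e0 <-]] /lt_limn_einf[N hN].
have := @decay_asymptotic_rate x e p'^-1 q' N.+1 e0.
rewrite invr_gt0 => /(_ pp); rewrite mulrC ltr_pdivlMr// mul1r => /(_ pq).
case=> [[//|n] Nn|d d0 qd].
  by rewrite -rate_ge//; apply/ltW/hN; exact: ltnW.
move: qi; apply/negP; rewrite -leNgt.
apply: (@le_trans _ _ (restricted_rate_at mu T x d)).
  by apply: ereal_inf_lbound; exists d.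
by apply: ereal_inf_lbound; exists q'.
Qed.

(** Not being slow with exponent 0 is exponential decay of the balls. *)
Lemma not_slow0_sensitive x e : 0 < e -> ~ slow T mu e 0 x ->
  exists2 d, 0 < d & restricted_sensitive_at mu T x d.
Proof.
move=> e0 /existsNP[k /not_implyP[_ /existsNP[m /not_implyP[_ h]]]].
pose c : R := k.+1%:R^-1; have c0 : 0 < c by rewrite invr_gt0.
have [|n mn|d d0 da] := @decay_asymptotic_rate x e c (2 / c) m e0 c0.
- by rewrite mulrCA divff ?gt_eqF// mulr1 ltr1n.
- rewrite leNgt; apply/negP => hn; apply: h; exists n => //.
  by rewrite /heavy/= add0r.
- by exists d => //; exists (2 / c).
Qed.

End RestrictedRate.

(** * Entropy of partitions *)

Lemma gibbs_inequality (R : realType) (I : finType) (p q : I -> R) :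
  (forall i, 0 <= p i) -> (forall i, 0 <= q i) ->
  (forall i, q i = 0 -> p i = 0) -> \sum_i q i <= \sum_i p i ->
  - \sum_i p i * ln (p i) <= - \sum_i p i * ln (q i).
Proof.
move=> p0 q0 qp0 qp; rewrite lerN2 -subr_ge0 -sumrB.
apply: (@le_trans _ _ (\sum_i (p i - q i))); first by rewrite sumrB subr_ge0.
apply: ler_sum => i _.
have [pi0|pi0] := eqVneq (p i) 0.
  by rewrite pi0 !mul0r subrr sub0r oppr_le0.
have pgt : 0 < p i by rewrite lt_neqAle eq_sym pi0 p0.
have qgt : 0 < q i.
  by rewrite lt_neqAle q0 andbT eq_sym; apply: contra_neq pi0; exact: qp0.
have : ln (q i / p i) <= q i / p i - 1.
  rewrite -[X in ln X](subrKC 1); apply: le_ln1Dx.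
  by rewrite ltrBrDl subrr divr_gt0.
rewrite ln_div ?posrE// => /(ler_wpM2l (ltW pgt)).
rewrite (_ : p i * (q i / p i - 1) = q i - p i); last by field.
lra.
Qed.

Lemma fekete (R : realType) (a : nat -> R) : (forall n, 0 <= a n) ->
  (forall n m, a (n + m)%N <= a n + a m) -> cvgn (fun n => a n / n%:R).
Proof.
move=> a0 sub.
pose S := [set a n.+1 / n.+1%:R | n in [set: nat]].
have hS : has_inf S.
  split; first by exists (a 1 / 1%:R), 0%N.
  by exists 0 => _ [n _ <-]; rewrite divr_ge0.
have infle n : inf S <= a n.+1 / n.+1%:R.
  by apply: ge_inf; [case: hS|exists n].
have mul k q : a (k * q)%N <= k%:R * a q + a 0%N.
  elim: k => [|k IH]; first by rewrite mul0n mul0r add0r.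
  rewrite mulSn -[k.+1]add1n natrD mulrDl mul1r -addrA.
  by apply: (le_trans (sub _ _)); rewrite lerD2l.
apply/cvg_ex; exists (inf S); apply/cvgrPdist_le => e e0.
have [_ [q _ <-] hq] := inf_adherent (divr_gt0 e0 (ltr0Sn _ 1)) hS.
pose C := a 0%N + \sum_(0 <= r < q.+1) a r.
have C0 : 0 <= C by rewrite addr_ge0// sumr_ge0.
near=> n.
have n0 : (0 < n)%N by near: n; exists 1%N.
have nC : C / (e / 2) <= n%:R.
  near: n; exists (Num.truncn (C / (e / 2))).+1 => // n /= hn.
  by rewrite (le_trans (ltW (truncnS_gt _)))// ler_nat.
have nR : 0 < n%:R :> R by rewrite ltr0n.
rewrite distrC ger0_norm; last by rewrite subr_ge0; case: (n) n0 => // n' _; exact: infle.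
rewrite lerBlDr.
have hr : a (n %% q.+1)%N <= \sum_(0 <= r < q.+1) a r.
  have mq : (n %% q.+1 < q.+1)%N by rewrite ltn_mod.
  rewrite big_mkord (bigD1 (Ordinal mq))//= lerDl.
  exact: sumr_ge0.
have an : a n <= (n %/ q.+1)%:R * a q.+1 + C.
  rewrite {1}(divn_eq n q.+1); apply: (le_trans (sub _ _)).
  by rewrite addrA lerD.
have dq : (n %/ q.+1)%:R <= n%:R / q.+1%:R :> R.
  by rewrite ler_pdivlMr// -natrM ler_nat leq_trunc_div.
rewrite ler_pdivrMr//; apply: (le_trans an).
have /= h1 := ler_wpM2r (a0 q.+1) dq.
have h2 : n%:R / q.+1%:R * a q.+1 <= n%:R * (inf S + e / 2).
  by rewrite -mulrA ler_wpM2l// mulrC ltW.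
have h3 : C <= e / 2 * n%:R by rewrite mulrC -ler_pdivrMr// divr_gt0.
apply: (le_trans (lerD (le_trans h1 h2) h3)); lra.
Unshelve. all: by end_near. Qed.

Section FinitePartitions.
Context {d : measure_display} {S : measurableType d} {R : realType}.
Context (mu : probability S R).

Lemma pr_disjoint_bigsetU (I : choiceType) (s : seq I) (F : I -> set S) : uniq s ->
  (forall i, measurable (F i)) -> (forall i j x, F i x -> F j x -> i = j) ->
  pr mu (\big[setU/set0]_(i <- s) F i) = \sum_(i <- s) pr mu (F i).
Proof.
move=> us mF dF; elim: s us => [|i s IH] /=; first by rewrite !big_nil /pr measure0.
move=> /andP[is_ us]; rewrite !big_cons -IH//.
rewrite {1}/pr measureU//; last 2 first.
- exact: bigsetU_measurable.
- rewrite -subset0 -bigcup_seq => x [Fi [j /= js Fj]].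
  by move: is_; rewrite (dF _ _ _ Fi Fj) js.
by rewrite fineD ?fin_num_measure//; exact: bigsetU_measurable.
Qed.

Lemma pr_total (I : finType) (F : I -> set S) (A : set S) : measurable A ->
  (forall i, measurable (F i)) -> (forall i j x, F i x -> F j x -> i = j) ->
  (forall x, exists i, F i x) ->
  pr mu A = \sum_i pr mu (A `&` F i).
Proof.
move=> mA mF dF cF.
rewrite -(pr_disjoint_bigsetU (index_enum_uniq I)).
- congr pr; apply/seteqP; split => x.
    move=> Ax; have [i Fi] := cF x; rewrite -bigcup_seq; exists i => //=.
    by rewrite mem_index_enum.
  by rewrite -bigcup_seq => -[i _ []].
- by move=> i; exact: measurableI.
- by move=> i j x [_ Fi] [_ Fj]; exact: dF Fi Fj.
Qed.

End FinitePartitions.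

Section JoinEntropy.
Context {R : realType} {X : pointedMetricType R} (T : X -> X).
Context (mu : probability (borelType X) R).
Context (contT : continuous T).
Context (invmu : invariant_measure mu T).
Context (k : nat) (P : 'I_k -> set (borelType X)).
Context (partP : measurable_partition P).

Notation word n := {ffun 'I_n -> 'I_k}.
Notation cell w := (join_cell T P w).
Notation H := (join_entropy mu T P).

Lemma partition_label x : {i | P i x}.
Proof. by apply: cid; case: partP => _ _ PT; have : [set: X] x by []; rewrite -PT => -[i _]; exists i. Qed.

(** Labelling points turns cells of joins into words, which can be counted. *)
Definition label x : 'I_k := sval (partition_label x).

Lemma labelP x i : P i x <-> i = label x.
Proof.
split=> [Pi|->]; last by rewrite /label; case: partition_label.
case: partP => _ /trivIsetP tP _; apply: contrapT => /eqP il.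
have := tP i (label x) I I il; rewrite -subset0 => /(_ x); apply.
by split => //; rewrite /label; case: partition_label.
Qed.

Definition itinerary n x : word n := [ffun i : 'I_n => label (iter i T x)].

Lemma join_cellP n (w : word n) x : cell w x <-> w = itinerary n x.
Proof.
split=> [h|->].
  by apply/ffunP => i; rewrite ffunE; apply/labelP; exact: (h i I).
by move=> i _; apply/labelP; rewrite ffunE.
Qed.

Lemma measurable_join_cell n (w : word n) : measurable (cell w).
Proof.
apply: fin_bigcap_measurable; first exact: finite_finset.
move=> i _; apply: (measurable_iter (measurable_preimage_borel contT)).
by case: partP.
Qed.

Lemma pr_join_cells n (A : set (borelType X)) : measurable A ->
  pr mu A = \sum_(w : word n) pr mu (A `&` cell w).
Proof.
move=> mA; apply: pr_total => //; first exact: measurable_join_cell.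
  by move=> v w x /join_cellP -> /join_cellP ->.
by move=> x; exists (itinerary n x); apply/join_cellP.
Qed.

Lemma sum_pr_join_cells n : \sum_(w : word n) pr mu (cell w) = 1.
Proof.
by rewrite -(prT mu) (@pr_join_cells n setT)//; apply: eq_bigr => w _; rewrite setTI.
Qed.

Lemma join_entropyE n : H n = - \sum_(w : word n) pr mu (cell w) * ln (pr mu (cell w)).
Proof. by []. Qed.

Lemma join_entropy_ge0 n : 0 <= H n.
Proof.
rewrite join_entropyE oppr_ge0 -oppr_ge0 -sumrN sumr_ge0// => w _.
by rewrite -mulrN mulr_ge0 ?pr_ge0// oppr_ge0 ln_le0// pr_le1//; exact: measurable_join_cell.
Qed.

Definition cat_word n m (uv : word n * word m) : word (n + m) :=
  [ffun i : 'I_(n + m) => match fintype.split i with inl a => uv.1 a | inr b => uv.2 b end].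

Lemma cat_word_bij n m : bijective (@cat_word n m).
Proof.
exists (fun w : word (n + m) =>
  ([ffun a : 'I_n => w (lshift m a)], [ffun b : 'I_m => w (rshift n b)])).
  move=> [u v]; congr (_, _); apply/ffunP => a; rewrite !ffunE.
    by rewrite (unsplitK (inl a)).
  by rewrite (unsplitK (inr a)).
move=> w; apply/ffunP => i; rewrite !ffunE.
by rewrite -[in RHS](splitK i); case: (fintype.split i) => a; rewrite ffunE.
Qed.

Lemma join_cell_cat n m u v :
  cell (@cat_word n m (u, v)) = cell u `&` iter n T @^-1` cell v.
Proof.
apply/seteqP; split => x.
  move=> h; split => i _ /=.
    by have := h (lshift m i) I; rewrite ffunE (unsplitK (inl i)).
  have := h (rshift n i) I; rewrite ffunE (unsplitK (inr i))/=.
  by rewrite addnC iterD.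
move=> [hu hv] i _; rewrite ffunE/=; have := splitK i.
case: (fintype.split i) => a <-; first exact: (hu a I).
by rewrite /= addnC iterD; exact: (hv a I).
Qed.

(** Gibbs' inequality against the product of the two marginal distributions,
    the second of which is shifted by [n] and hence unchanged. *)
Lemma join_entropy_subadditive n m : H (n + m)%N <= H n + H m.
Proof.
have mc l (w : word l) := measurable_join_cell w.
have mTc l i (w : word l) : measurable (iter i T @^-1` cell w : set (borelType X)).
  exact: (measurable_iter (measurable_preimage_borel contT)).
pose pu (u : word n) := pr mu (cell u); pose pv (v : word m) := pr mu (cell v).
pose p uv := pr mu (cell (@cat_word n m uv)).
have reidx (F : word (n + m) -> R) : \sum_w F w = \sum_uv F (@cat_word n m uv).
  by rewrite (reindex _ (onW_bij _ (@cat_word_bij n m))).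
have pp u v : p (u, v) = pr mu (cell u `&` iter n T @^-1` cell v).
  by rewrite /p join_cell_cat.
have ple1 u v : p (u, v) <= pu u.
  by rewrite pp; apply: pr_le => //; exact: measurableI.
have ple2 u v : p (u, v) <= pv v.
  rewrite pp /pv -[leRHS](pr_iter (measurable_preimage_borel contT) invmu n)//.
  by apply: pr_le => //; exact: measurableI.
rewrite join_entropyE reidx -/p.
apply: (@le_trans _ _ (- \sum_uv p uv * ln (pu uv.1 * pv uv.2))).
  apply: gibbs_inequality.
  - by move=> uv; exact: pr_ge0.
  - by move=> uv; rewrite mulr_ge0 ?pr_ge0.
  - move=> [u v] /= /eqP; rewrite mulf_eq0 => /orP[] /eqP h0; apply/eqP; rewrite eq_le pr_ge0 andbT.
      by rewrite -h0 ple1.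
    by rewrite -h0 ple2.
  - rewrite -(reidx (fun w => pr mu (cell w))) sum_pr_join_cells.
    rewrite -(pair_bigA _ (fun u v => pu u * pv v))/=.
    under eq_bigr do rewrite -mulr_sumr sum_pr_join_cells mulr1.
    by rewrite sum_pr_join_cells.
rewrite (eq_bigr (fun uv => p uv * ln (pu uv.1) + p uv * ln (pv uv.2))); last first.
  move=> [u v] _ /=; have [p0|p0] := eqVneq (p (u, v)) 0; first by rewrite p0 !mul0r addr0.
  have pgt : 0 < p (u, v) by rewrite lt_neqAle eq_sym p0 pr_ge0.
  by rewrite -mulrDr lnM// posrE; apply: lt_le_trans pgt _.
have mu1 : \sum_uv p uv * ln (pu uv.1) = \sum_u pu u * ln (pu u).
  rewrite (eq_bigr (fun uv => p (uv.1, uv.2) * ln (pu uv.1))); last by case.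
  rewrite -(pair_bigA _ (fun u v => p (u, v) * ln (pu u)))/=.
  apply: eq_bigr => u _; rewrite -mulr_suml; congr (_ * _).
  under eq_bigr do rewrite pp.
  rewrite -(pr_total mu (F := fun w : word m => iter n T @^-1` cell w))//.
    by move=> v w x /join_cellP -> /join_cellP ->.
  by move=> x; exists (itinerary m (iter n T x)); apply/join_cellP.
have mv1 : \sum_uv p uv * ln (pv uv.2) = \sum_v pv v * ln (pv v).
  rewrite (eq_bigr (fun uv => p (uv.1, uv.2) * ln (pv uv.2))); last by case.
  rewrite -(pair_bigA _ (fun u v => p (u, v) * ln (pv v)))/= exchange_big/=.
  apply: eq_bigr => v _; rewrite -mulr_suml; congr (_ * _).
  under eq_bigr do rewrite pp setIC.
  rewrite -pr_join_cells// /pv; exact: (pr_iter (measurable_preimage_borel contT) invmu n).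
by rewrite big_split/= opprD mu1 mv1.
Qed.

Lemma join_entropy_cvg : cvgn (fun n => H n / n%:R).
Proof. exact: fekete join_entropy_ge0 join_entropy_subadditive. Qed.

Lemma join_entropy_ge n (A : set (borelType X)) c : measurable A -> 0 <= c ->
  (forall x, A x -> pr mu (cell (itinerary n x)) <= expR (- c)) ->
  c * pr mu A <= H n.
Proof.
move=> mA c0 h; rewrite join_entropyE (@pr_join_cells n A)// mulr_sumr -sumrN.
apply: ler_sum => w _; set p := pr mu (cell w).
have p0 : 0 <= p by exact: pr_ge0.
have p1 : p <= 1 by apply: pr_le1; exact: measurable_join_cell.
have nln0 : 0 <= - (p * ln p) by rewrite -mulrN mulr_ge0// oppr_ge0 ln_le0.
have [[x [Ax wx]]|/set0P/negP/negPn/eqP ->] := pselect (A `&` cell w !=set0); last first.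
  by rewrite [X in c * X](_ : _ = 0) ?mulr0// /pr measure0.
have Ap : pr mu (A `&` cell w) <= p.
  by apply: pr_le => //; [apply: measurableI => //|]; exact: measurable_join_cell.
have [pz|pz] := eqVneq p 0.
  rewrite (_ : pr mu (A `&` cell w) = 0) ?mulr0//.
  by apply/eqP; rewrite eq_le pr_ge0 andbT -pz.
have pgt : 0 < p by rewrite lt_neqAle eq_sym pz.
have := h _ Ax; rewrite -((join_cellP w x).1 wx) -/p -{1}(lnK (pgt : p \is Num.pos)) ler_expR lerNr => lnp.
rewrite -mulrN mulrC; apply: (le_trans (ler_wpM2r c0 Ap)).
exact: ler_wpM2l.
Qed.

Lemma label_card_gt0 : (0 < k)%N.
Proof. by case: (label point) => i; exact: leq_ltn_trans. Qed.

(** Gibbs' inequality against the distribution that spreads half of its mass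
    evenly over [W], bounded in size by [Q], and the other half over all words. *)
Lemma join_entropy_le n (W : {set word n}) (Q th : R) : 1 <= Q ->
  #|W|%:R <= Q -> \sum_(w | w \notin W) pr mu (cell w) <= th ->
  H n <= ln 2 + ln Q + th * (n%:R * ln k%:R).
Proof.
move=> Q1 WQ Wth; have Q0 : 0 < Q by exact: lt_le_trans Q1.
have k0 : 0 < k%:R :> R by rewrite ltr0n label_card_gt0.
have kn0 : 0 < k%:R ^+ n :> R by rewrite exprn_gt0.
have lnk0 : 0 <= n%:R * ln (k%:R : R).
  by rewrite mulr_ge0// ln_ge0// ler1n label_card_gt0.
pose q (w : word n) : R := if w \in W then (2 * Q)^-1 else (2 * k%:R ^+ n)^-1.
have q0 w : 0 < q w by rewrite /q; case: ifP => _; rewrite invr_gt0 mulr_gt0.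
have qsum : \sum_w q w <= 1.
  rewrite (bigID (mem W))/=.
  rewrite (eq_bigr (fun=> (2 * Q)^-1)); last by move=> w wW; rewrite /q wW.
  rewrite [X in _ + X](eq_bigr (fun=> (2 * k%:R ^+ n)^-1)); last first.
    by move=> w /negbTE wW; rewrite /q wW.
  rewrite [leRHS](splitr 1) lerD//.
    rewrite sumr_const -[leLHS]mulr_natl ler_pdivrMr ?mulr_gt0//.
    by apply: (le_trans WQ); lra.
  apply: (@le_trans _ _ (\sum_(w : word n) (2 * k%:R ^+ n)^-1)).
    by rewrite [leRHS](bigID (mem W))/= lerDr sumr_ge0.
  rewrite sumr_const card_ffun !card_ord -[leLHS]mulr_natl natrX invfM mulrCA.
  by rewrite divff ?gt_eqF// mulr1 mul1r.
rewrite join_entropyE.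
apply: (le_trans (gibbs_inequality (q := q) _ _ _ _)).
- by move=> w; exact: pr_ge0.
- by move=> w; exact: ltW.
- by move=> w /eqP; rewrite gt_eqF.
- by rewrite sum_pr_join_cells.
rewrite -sumrN.
have -> : ln 2 + ln Q = \sum_(w : word n) pr mu (cell w) * (ln 2 + ln Q).
  by rewrite -mulr_suml sum_pr_join_cells mul1r.
apply: (@le_trans _ _ (\sum_(w : word n) pr mu (cell w) * (ln 2 + ln Q) +
   \sum_(w | w \notin W) pr mu (cell w) * (n%:R * ln k%:R))); last first.
  by rewrite lerD2l -mulr_suml ler_wpM2r.
rewrite [X in _ + X]big_mkcond/= -big_split/=; apply: ler_sum => w _.
rewrite /q -mulrN; case: ifP => wW /=.
  by rewrite lnV ?posrE ?mulr_gt0// opprK lnM ?posrE// addr0.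
rewrite lnV ?posrE ?mulr_gt0// opprK lnM ?posrE// lnXn// -[_ *+ n]mulr_natl.
have : 0 <= pr mu (cell w) * ln Q by rewrite mulr_ge0 ?pr_ge0 ?ln_ge0.
lra.
Qed.

End JoinEntropy.

(** * Positive entropy from sensitivity *)

Section PositiveEntropy.
Context {R : realType} {X : pointedMetricType R} (T : X -> X).
Context (mu : probability (borelType X) R).
Context (contT : continuous T).
Context (invmu : invariant_measure mu T).
Context (compactX : compact [set: X]).

Notation ball_pr n x e := (pr mu (bowen_ball T n x e)).

(** Disjointify a finite cover by small balls: a point goes to the first set of
    the cover that contains it. *)
Lemma exists_small_partition (e : R) : 0 < e ->
  exists (k : nat) (P : 'I_k -> set (borelType X)), measurable_partition P /\
    forall i y z, P i y -> P i z -> mdist y z < e.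
Proof.
move=> e0; have [K [I [A [_ oA sA cA]]]] := coverable1 T e0 compactX.
pose C (i : 'I_#|I|) := A (enum_val i).
have mC i : measurable (C i : set (borelType X)).
  by apply: open_measurable_borel; exact: oA.
exists #|I|, (fun i => C i `\` \bigcup_(j in [set j : 'I_#|I| | (j < i)%N]) C j).
split; last by move=> i y z [Cy _] [Cz _]; exact: (sA _ _ _ Cy Cz 0%N).
split.
- move=> i; apply: measurableD => //.
  by apply: fin_bigcup_measurable => // j _; exact: finite_finset.
- have lt i j x : C i x -> ~ (\bigcup_(l in [set l : 'I_#|I| | (l < j)%N]) C l) x -> (j <= i)%N.
    by move=> Ci nC; rewrite leqNgt; apply/negP => ij; apply: nC; exists i.
  move=> i j _ _ [x [[Ci ni] [Cj nj]]]; apply/val_inj/eqP.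
  by rewrite eqn_leq (lt j i x Cj ni) (lt i j x Ci nj).
- apply/seteqP; split => // x _.
  have [i0 _ Ai0] := cA x Logic.I.
  have P0 : `[< C (enum_rank i0) x >] by apply/asboolP; rewrite /C enum_rankK.
  case: (@arg_minnP _ (enum_rank i0) (fun i => `[< C i x >]) (fun i => i : nat) P0) => i /asboolP Ci mini.
  exists i => //; split => // -[j /= ji Cj].
  by have := mini j (asboolT Cj); rewrite leqNgt ji.
Qed.

(** The same parameter bounds the radius and the speed of decay, so that these
    sets increase with [j]. *)
Definition fast (j : nat) : set (borelType X) :=
  \bigcap_k (~` heavy T mu k j.+1%:R^-1 (expR (- (j.+1%:R^-1 * k.+1%:R)))).

Lemma measurable_fast j : measurable (fast j).
Proof.
apply: bigcap_measurable => // k _; apply: measurableC.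
by apply: measurable_heavy => //; rewrite invr_gt0.
Qed.

Lemma fastP j x : fast j x <->
  forall k, ball_pr k x j.+1%:R^-1 <= expR (- (j.+1%:R^-1 * k.+1%:R)).
Proof.
split => h k; first by have := h k I; rewrite /heavy /= => /negP; rewrite -leNgt.
by move=> _; rewrite /heavy /=; apply/negP; rewrite -leNgt.
Qed.

Lemma ball_pr_le k x e f : 0 < e -> e <= f -> ball_pr k x e <= ball_pr k x f.
Proof.
move=> e0 ef; apply: pr_le; last exact: bowen_ball_le.
- exact: measurable_bowen_ball.
- by apply: measurable_bowen_ball => //; exact: lt_le_trans ef.
Qed.

Lemma fast_nondec j : fast j `<=` fast j.+1.
Proof.
move=> x /fastP h; apply/fastP => k.
have j0 : 0 < j.+2%:R^-1 :> R by rewrite invr_gt0.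
have jj : j.+2%:R^-1 <= j.+1%:R^-1 :> R by rewrite lef_pV2 ?posrE// ler_nat.
apply: (le_trans (ball_pr_le k x j0 jj)); apply: (le_trans (h k)).
by rewrite ler_expR lerN2 ler_wpM2r.
Qed.

Lemma sensitive_fast x d : 0 < d -> restricted_sensitive_at mu T x d ->
  (\bigcup_j fast j) x.
Proof.
move=> d0 [a ad]; have a0 : 0 < a by case: ad.
have dec := asymptotic_rate_decay contT d0 ad.
have m0 : 0 < Num.min d a^-1 by rewrite lt_min d0 invr_gt0.
have [j] := exists_natSinv_le m0; rewrite le_min => /andP[jd ja].
exists j => //; apply/fastP => k.
apply: (le_trans (ball_pr_le k x _ jd)); first by rewrite invr_gt0.
by apply: (le_trans (dec k)); rewrite ler_expR lerN2 ler_wpM2r.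
Qed.

Theorem restricted_sensitive_entropy_gt0 :
  restricted_sensitive mu T -> (0 < measure_entropy mu T)%E.
Proof.
move=> [N [mN N0 hN]].
have mNC := measurableC mN.
have Nfast : ~` N `<=` \bigcup_j fast j.
  move=> x nN; have : exists2 d : R, 0 < d & restricted_sensitive_at mu T x d.
    by apply: contrapT => nx; apply: nN; exact: hN.
  by move=> [d]; exact: sensitive_fast.
have [|j hj] := pr_approx_bigcup mu mNC measurable_fast fast_nondec Nfast (th := 2^-1).
  by rewrite invr_gt0.
have prN : pr mu (~` N) = 1 by rewrite prC// /pr N0 subr0.
have prf : 2^-1 <= pr mu (fast j).
  have := pr_le_addD mu mNC (measurable_fast j).
  lra.
pose e : R := j.+1%:R^-1; have e0 : 0 < e by rewrite invr_gt0.
have [k [P [partP diamP]]] := exists_small_partition e0.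
have Hge n : e * n%:R * pr mu (fast j) <= join_entropy mu T P n.
  apply: (join_entropy_ge (partP := partP) contT (measurable_fast j)).
    by rewrite mulr_ge0// ltW.
  case: n => [|n] x /fastP h.
    by rewrite mulr0 oppr0 expR0; apply: pr_le1; exact: measurable_join_cell.
  apply: le_trans (h n); apply: pr_le.
  - exact: measurable_join_cell.
  - exact: measurable_bowen_ball.
  - have xx : join_cell T P (itinerary T partP n.+1 x) x by apply/join_cellP.
    move=> y hy; apply/bowen_ballP => // i ni.
    exact: (diamP _ _ _ (xx (Ordinal (ni : (i < n.+1)%N)) I) (hy (Ordinal (ni : (i < n.+1)%N)) I)).
apply: (@lt_le_trans _ _ (partition_entropy mu T P)%:E); last first.
  by apply: ereal_sup_ubound; exists k, P; split.
rewrite lte_fin; apply: (@lt_le_trans _ _ (e * 2^-1)); first by rewrite mulr_gt0// invr_gt0.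
apply: limr_ge; first exact: join_entropy_cvg.
exists 1%N => // n /= n0; rewrite ler_pdivlMr ?ltr0n//.
apply: le_trans (Hge n). by rewrite mulrAC ler_wpM2l// mulr_ge0// ltW.
Qed.

End PositiveEntropy.

(** * Zero entropy when balls decay slowly *)

Section HammingBall.
Context {R : realType} (n k : nat).
Implicit Types u w : {ffun 'I_n -> 'I_k}.

Definition hamming u w : nat := \sum_(i < n) (u i != w i).

(** Give a word at distance h from [u] the weight t ^ - h.  The total weight is
    a product over the positions, at most (1 + k/t) ^ n, and a word of the ball
    weighs at least t ^ - b. *)
Lemma card_hamming_ball u (b : nat) (t : R) : 1 <= t ->
  #|[set w | (hamming u w <= b)%N]%SET|%:R <= t ^+ b * (1 + k%:R / t) ^+ n.
Proof.
move=> t1; have t0 : 0 < t by exact: lt_le_trans t1.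
have wt w : \prod_(i < n) (if u i == w i then 1 else t^-1) = t^-1 ^+ hamming u w.
  rewrite /hamming; elim/big_rec2 : _ => [|i y1 y2 _ ->]; first by rewrite expr0.
  by case: eqP => _ /=; rewrite ?mul1r// exprS.
have sumE : \sum_w t^-1 ^+ hamming u w = \prod_(i < n) \sum_(j < k) (if u i == j then 1 else t^-1).
  by rewrite bigA_distr_bigA; apply: eq_bigr => w _; rewrite wt.
apply: (@le_trans _ _ (\sum_w t ^+ b * t^-1 ^+ hamming u w)).
  rewrite -sum1_card natr_sum [leRHS](bigID (mem [set w | (hamming u w <= b)%N]%SET))/=.
  rewrite -[leLHS]addr0 lerD//.
    apply: ler_sum => w; rewrite inE => hb.
    by rewrite exprVn -expfB_cond ?gt_eqF// exprn_ege1.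
  by rewrite sumr_ge0// => w _; rewrite mulr_ge0// exprn_ge0// ?invr_ge0 ltW.
rewrite -mulr_sumr sumE ler_wpM2l ?exprn_ge0 ?(ltW t0)//.
have -> : (1 + k%:R / t) ^+ n = \prod_(i < n) (1 + k%:R / t).
  by rewrite prodr_const card_ord.
apply: ler_prod => i _; apply/andP; split.
  by rewrite sumr_ge0// => j _; case: ifP => // _; rewrite invr_ge0 ltW.
rewrite (bigD1 (u i))//= eqxx lerD2l.
apply: (@le_trans _ _ (\sum_(j < k) t^-1)).
  rewrite [leRHS](bigD1 (u i))//= -[leLHS]add0r lerD ?invr_ge0 ?(ltW t0)//.
  by apply: ler_sum => j ij; rewrite eq_sym (negbTE ij).
by rewrite sumr_const card_ord mulrC mulr_natr.
Qed.

End HammingBall.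

Section LusinPartitions.
Context {R : realType} {X : pointedMetricType R}.
Context (mu : probability (borelType X) R).

(** A form of Lusin's theorem for indicator functions: outside of a small set,
    membership in [A] is locally constant at a uniform scale. *)
Definition almost_clopen (A : set X) := forall th : R, 0 < th ->
  exists W : set (borelType X), [/\ measurable W, pr mu W <= th &
    exists2 e : R, 0 < e & forall x y, ~ W x -> ~ W y -> mdist x y < e -> A x -> A y].

(** Discard the points of [A] that are close to its complement. *)
Lemma almost_clopen_open A : open A -> almost_clopen A.
Proof.
move=> oA th th0.
pose F (n : nat) : set (borelType X) := A `&` \bigcup_(y in ~` A) [set x | mdist y x < n.+1%:R^-1].
have oF n : open (F n).
  apply: openI => //; apply: bigcup_open => y _; exact: open_mdist_ball.
have mF n : measurable (F n) by exact: open_measurable_borel.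
have [||n Fn] := pr_noninc_small mu mF _ _ th0.
- move=> n x [Ax [y nAy yx]]; split => //; exists y => //=.
  by apply: (lt_le_trans yx); rewrite lef_pV2 ?posrE// ler_nat.
- rewrite -subset0 => x h; have [Ax _] := h 0%N I.
  have /nbhs_ballP[r /= r0 rA] : nbhs x A by exact: open_nbhs_nbhs.
  have [n nr] := exists_natSinv_le r0.
  have [_ [y nAy /= yx]] := h n I; apply: nAy; apply: rA.
  by rewrite ballEmdist /= metric_sym (lt_le_trans yx).
exists (F n); split => //; exists n.+1%:R^-1; first by rewrite invr_gt0.
move=> x y nFx _ xy Ax; apply: contrapT => nAy; apply: nFx; split => //.
by exists y => //=; rewrite metric_sym.
Qed.

Lemma almost_clopenC A : almost_clopen A -> almost_clopen (~` A).
Proof.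
move=> h th th0; have [W [mW pW [e e0 hW]]] := h th th0.
exists W; split => //; exists e => // x y nx ny xy nAx Ay; apply: nAx.
by apply: hW Ay => //; rewrite metric_sym.
Qed.

Lemma almost_clopen_fin (I : finType) (A : I -> set X) (th : R) : 0 < th ->
  (forall i, almost_clopen (A i)) ->
  exists W : set (borelType X), [/\ measurable W, pr mu W <= th &
    exists2 e : R, 0 < e & forall x y i, ~ W x -> ~ W y -> mdist x y < e -> A i x -> A i y].
Proof.
move=> th0 hA; pose t := th / (#|I|.+1)%:R.
have t0 : 0 < t by rewrite divr_gt0.
have /choice[W hW] : forall i, exists W : set (borelType X), [/\ measurable W, pr mu W <= t &
    exists2 e : R, 0 < e & forall x y, ~ W x -> ~ W y -> mdist x y < e -> A i x -> A i y].
  by move=> i; exact: hA.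
have /choice[e he] : forall i, exists e : R, 0 < e /\
    forall x y, ~ W i x -> ~ W i y -> mdist x y < e -> A i x -> A i y.
  by move=> i; have [_ _ [e e0 h]] := hW i; exists e.
have mW i : measurable (W i) by case: (hW i).
exists (\big[setU/set0]_i W i); split; first exact: bigsetU_measurable.
  apply: (le_trans (pr_bigsetU_le _ _ _ mW)).
  apply: (@le_trans _ _ (\sum_(i : I) t)); first by apply: ler_sum => i _; case: (hW i).
  rewrite sumr_const -[leLHS]mulr_natl /t mulrA ler_pdivrMr// mulrC.
  by rewrite ler_pM2l// ler_nat.
exists (\big[Num.min/1]_i e i).
  by apply/bigmin_gtP; split => // i _; case: (he i).
move=> x y i nx ny xy; apply: (proj2 (he i)).
- by apply: contra_not nx => Wx; rewrite (bigD1 i)//=; left.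
- by apply: contra_not ny => Wx; rewrite (bigD1 i)//=; left.
- by apply: (lt_le_trans xy); exact: bigmin_le_cond.
Qed.

(** These sets form a sigma-algebra: in a countable union, finitely many terms
    suffice up to small measure. *)
Lemma almost_clopen_measurable (A : set (borelType X)) : measurable A -> almost_clopen A.
Proof.
move=> mA; pose P (B : set X) := measurable (B : set (borelType X)) /\ almost_clopen B.
suff [] : P A by [].
apply: (borel_ind (P := P)) mA => [|B oB]; last first.
  by split; [exact: open_measurable_borel|exact: almost_clopen_open].
split.
- by split; [exact: measurable0|apply: almost_clopen_open; exact: open0].
- by move=> B [mB hB]; rewrite setTD; split; [exact: measurableC|exact: almost_clopenC].
move=> F hF; have mF n : measurable (F n : set (borelType X)) by case: (hF n).
have mU : measurable (\bigcup_n F n : set (borelType X)) by exact: bigcup_measurable.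
split => // th th0.
have t0 : 0 < th / 2 by rewrite divr_gt0.
pose D N : set (borelType X) := (\bigcup_n F n) `\` \big[setU/set0]_(n < N) F n.
have mD N : measurable (D N) by apply: measurableD => //; exact: bigsetU_measurable.
have [||N DN] := pr_noninc_small mu mD _ _ t0.
- move=> n x [Ux nx]; split => // h; apply: nx.
  by rewrite big_ord_recr/=; left.
- rewrite -subset0 => x h; have [[n _ Fn] _] := h 0%N I.
  by have [_] := h n.+1 I; apply; rewrite big_ord_recr/=; right.
have [W [mW pW [e e0 hW]]] := almost_clopen_fin t0 (fun i : 'I_N => (hF i).2).
exists (W `|` D N); split; first exact: measurableU.
  by apply: (le_trans (prU_le _ mW (mD N))); rewrite [leRHS]splitr lerD.
exists e => // x y nx ny xy Ux.
have : (\big[setU/set0]_(n < N) F n) x.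
  by apply: contrapT => nF; apply: nx; right.
rewrite -bigcup_mkord => -[i /= iN Fi]; exists i => //.
by apply: (hW x y (Ordinal iN)) => //; [move=> ?; apply: nx; left|move=> ?; apply: ny; left].
Qed.

End LusinPartitions.

Section ZeroEntropy.
Context {R : realType} {X : pointedMetricType R} (T : X -> X).
Context (mu : probability (borelType X) R).
Context (contT : continuous T).
Context (invmu : invariant_measure mu T).
Context (compactX : compact [set: X]).
Context (k : nat) (P : 'I_k -> set (borelType X)).
Context (partP : measurable_partition P).
Context (slowP : forall e : R, 0 < e -> pr mu (~` slow T mu e 0) = 0).

Notation H := (join_entropy mu T P).
Notation itin := (itinerary T partP).

(** Where neither orbit is in the exceptional set [W], closeness forces equal
    labels. *)
Lemma hamming_itinerary (W A : set (borelType X)) (e : R) (n : nat) y z :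
  (forall x y i, ~ W x -> ~ W y -> mdist x y < e -> P i x -> P i y) ->
  orbit_close T e n A -> A y -> A z ->
  (hamming (itin n y) (itin n z) <=
    @visits _ (borelType X) T y W n + @visits _ (borelType X) T z W n)%N.
Proof.
move=> hW cA Ay Az; rewrite /hamming /visits !big_mkord -big_split/=.
apply: leq_sum => i _; rewrite !ffunE.
have [yW|yW] := boolP (iter i T y \in W); first by rewrite (leq_trans (leq_b1 _)).
have [zW|zW] := boolP (iter i T z \in W); first by rewrite leq_b1.
rewrite notin_setE in yW; rewrite notin_setE in zW.
have Py : P (label partP (iter i T y)) (iter i T y) by apply/labelP.
have := hW _ _ _ yW zW (cA _ _ Ay Az i (ltn_ord i)) Py.
by move=> /labelP ->; rewrite eqxx.
Qed.

(** Points outside a small set have itineraries in few Hamming balls: one for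
    each set of a cover of [slow_cover] with exponent 0, around the itinerary
    of one of its points, with a radius given by the frequency of visits to the
    exceptional set of the Lusin property. *)
Lemma join_entropy_sublinear (delta : R) : 0 < delta ->
  exists C : R, forall n, H n <= delta * n%:R + C.
Proof.
move=> delta0; pose g := delta / 4; have g0 : 0 < g by rewrite divr_gt0.
have kgt := label_card_gt0 partP.
have k0 : 0 < k%:R :> R by rewrite ltr0n.
(* The weight t of a wrong letter makes 1 + k/t at most exp g; then eta is small
   enough that 2 eta n wrong letters cost at most exp (g n). *)
pose t := 1 + k%:R / g; have t1 : 1 <= t by rewrite lerDl divr_ge0// ltW.
have t0 : 0 < t by exact: lt_le_trans t1.
have ktg : k%:R / t <= g.
  by rewrite ler_pdivrMr// /t mulrDr mulr1 mulrC divfK ?gt_eqF// lerDr ltW.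
pose eta := g / (2 * (ln t + 1)).
have lnt0 : 0 <= ln t by exact: ln_ge0.
have eta0 : 0 < eta by rewrite divr_gt0// mulr_gt0// ltr_wpDl.
have etat : 2 * eta * ln t <= g.
  have L1 : 0 < ln t + 1 by rewrite ltr_wpDl.
  rewrite (_ : 2 * eta * ln t = g * (ln t / (ln t + 1))); last first.
    by rewrite /eta; field; rewrite gt_eqF.
  by rewrite -[leRHS]mulr1 ler_wpM2l ?(ltW g0)// ler_pdivrMr// mul1r lerDl.
(* Points outside the good set will have measure at most 2 th, hence contribute
   at most 2 th n log k to the entropy. *)
pose th := g / (2 * k%:R).
have th0 : 0 < th by rewrite divr_gt0// mulr_gt0.
have [W [mW pW [e e0 hW]]] := almost_clopen_fin (mulr_gt0 eta0 th0)
  (fun i => almost_clopen_measurable mu (let: And3 mP _ _ := partP in mP i)).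
have e40 : 0 < e / 4 by rewrite divr_gt0.
have [G [mG pG [C hC]]] := slow_cover contT invmu compactX e40 (lexx 0) g0 th0.
have mT := measurable_preimage_borel contT.
pose rare := @rarely_visiting _ (borelType X) R T W eta.
have mrare : measurable rare by exact: measurable_rarely_visiting.
have prare : pr mu (~` rare) <= th.
  rewrite -(ler_pM2l eta0); apply: le_trans pW.
  exact: (maximal_ergodic_inequality mT invmu mW (ltW eta0)).
pose G' : set (borelType X) := G `&` rare.
have mG' : measurable G' by exact: measurableI.
have mslow := measurable_slow mu contT 0 e40.
have pG' : pr mu (~` G') <= 2 * th.
  have mD : measurable (slow T mu (e / 4) 0 `\` G : set (borelType X)).
    exact: measurableD.
  apply: (@le_trans _ _ (pr mu ((~` slow T mu (e / 4) 0 `|` (slow T mu (e / 4) 0 `\` G)) `|` ~` rare))).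
    apply: pr_le.
    - exact: measurableC.
    - apply: measurableU; last exact: measurableC.
      by apply: measurableU => //; exact: measurableC.
    - move=> x nG'; have [rx|] := pselect (rare x); [left|by right].
      have [sx|] := pselect (slow T mu (e / 4) 0 x); [right|by left].
      by split => // Gx; apply: nG'.
  apply: (le_trans (prU_le _ _ _)).
  - by apply: measurableU => //; exact: measurableC.
  - exact: measurableC.
  apply: (@le_trans _ _ (th + th)); last lra.
  apply: lerD => //; apply: (le_trans (prU_le _ _ _)) => //; first exact: measurableC.
  by rewrite slowP// add0r.
pose C1 := Num.max C 1.
have C10 : 0 < C1 by rewrite lt_max ltr01 orbT.
exists (ln 2 + ln C1) => n.
have [I [A [IC oA cA GA]]] := hC n.
(* If A i does not meet G', the centre u i is arbitrary. *)
pose u i := itin n (xget point (G' `&` A i)).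
pose b := Num.truncn (2 * eta * n%:R).
pose V := [set w | [exists i, (hamming (u i) w <= b)%N]]%SET.
have VQ : #|V|%:R <= C1 * expR (3 * g * n%:R).
  apply: (@le_trans _ _ (\sum_(i : I) #|[set w | (hamming (u i) w <= b)%N]%SET|%:R)).
    rewrite -natr_sum ler_nat.
    under [leqRHS]eq_bigr do rewrite -sum1dep_card big_mkcond.
    rewrite exchange_big/= -sum1dep_card big_mkcond/=; apply: leq_sum => w _.
    by case: existsP => // -[i hi]; rewrite (bigD1 i)//= hi.
  apply: (@le_trans _ _ (\sum_(i : I) t ^+ b * (1 + k%:R / t) ^+ n)).
    by apply: ler_sum => i _; exact: card_hamming_ball.
  rewrite sumr_const -[leLHS]mulr_natl.
  have kt0 : 0 <= k%:R / t by rewrite divr_ge0// ltW.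
  have h1 : #|I|%:R <= C1 * expR (g * n%:R).
    by apply: (le_trans IC); rewrite ler_wpM2r ?expR_ge0// le_max lexx.
  have h2 : t ^+ b <= expR (g * n%:R).
    have tb0 : 0 < t ^+ b by rewrite exprn_gt0.
    rewrite -[leLHS](lnK tb0) ler_expR lnXn// -[_ *+ b]mulr_natl.
    apply: (@le_trans _ _ (2 * eta * n%:R * ln t)).
      by rewrite ler_wpM2r// truncn_le mulr_ge0// mulr_ge0// ltW.
    by rewrite mulrAC ler_wpM2r.
  have h3 : (1 + k%:R / t) ^+ n <= expR (g * n%:R).
    rewrite expRM_natr lerXn2r ?nnegrE ?expR_ge0 ?addr_ge0//.
    by apply: le_trans (expR_ge1Dx _); rewrite lerD2l.
  rewrite (_ : 3 * g * n%:R = g * n%:R + (g * n%:R + g * n%:R)); last by ring.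
  have tb0 : 0 <= t ^+ b by rewrite exprn_ge0// ltW.
  have ktn0 : 0 <= (1 + k%:R / t) ^+ n by rewrite exprn_ge0// addr_ge0.
  rewrite !expRD [leRHS]mulrA; apply: ler_pM => //; first exact: mulr_ge0.
  exact: ler_pM.
have Vout : \sum_(w | w \notin V) pr mu (join_cell T P w) <= 2 * th.
  apply: le_trans pG'.
  rewrite (pr_join_cells mu contT partP n (measurableC mG')).
  rewrite [leRHS](bigID (mem V))/= -[leLHS]add0r lerD//.
    by rewrite sumr_ge0// => w _; exact: pr_ge0.
  apply: ler_sum => w nV; apply: pr_le; first exact: measurable_join_cell.
    by apply: measurableI; [exact: measurableC|exact: measurable_join_cell].
  move=> x wx; split => // -[Gx rx]; move: nV; rewrite inE => /negP; apply.
  have [i _ Ax] := GA x Gx.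
  apply/existsP; exists i; rewrite ((join_cellP T partP w x).1 wx).
  rewrite /u; case: xgetP => [y _ [[Gy ry] Ay]|/(_ x) ny]; last by exfalso; exact: ny.
  have e2n : 0 <= 2 * eta * n%:R by rewrite mulr_ge0// mulr_ge0// (ltW eta0).
  rewrite truncn_ge_nat//.
  have cAi : orbit_close T e n (A i).
    by move: (cA i); rewrite [4 * _]mulrC divfK.
  apply: (@le_trans _ _ (eta * n%:R + eta * n%:R)); last lra.
  apply: le_trans (lerD (ry n) (rx n)); rewrite -natrD ler_nat.
  exact: hamming_itinerary hW cAi Ay Ax.
have C1e : 1 <= C1 * expR (3 * g * n%:R).
  rewrite -[leLHS]mulr1 ler_pM//; first by rewrite le_max lexx orbT.
  by rewrite -expR0 ler_expR !mulr_ge0// ltW.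
apply: (le_trans (join_entropy_le contT partP C1e VQ Vout)).
rewrite lnM ?posrE ?expR_gt0// expRK.
have lnk : ln (k%:R : R) <= k%:R by rewrite ltW// ln_sublinear.
have : 2 * th * (n%:R * ln k%:R) <= g * n%:R.
  apply: (@le_trans _ _ (2 * th * (n%:R * k%:R))).
    apply: ler_wpM2l; first by rewrite mulr_ge0// (ltW th0).
    exact: ler_wpM2l.
  rewrite le_eqVlt; apply/orP; left; apply/eqP; rewrite /th; field.
  by rewrite gt_eqF.
rewrite (_ : delta = 4 * g); last by rewrite /g; field.
lra.
Qed.

Theorem partition_entropy_zero : partition_entropy mu T P = 0.
Proof.
apply: cvg_lim => //; apply/cvgrPdist_le => e e0.
have e20 : 0 < e / 2 by rewrite divr_gt0.
have [C hC] := join_entropy_sublinear e20.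
near=> n.
have n0 : 0 < n%:R :> R by rewrite ltr0n; near: n; exists 1%N.
have nC : C / (e / 2) <= n%:R.
  near: n; exists (Num.truncn (C / (e / 2))).+1 => // n /= hn.
  by rewrite (le_trans (ltW (truncnS_gt _)))// ler_nat.
rewrite sub0r normrN ger0_norm; last by rewrite divr_ge0// join_entropy_ge0.
rewrite ler_pdivrMr//; apply: (le_trans (hC n)).
move: nC; rewrite ler_pdivrMr//; lra.
Unshelve. all: by end_near. Qed.

End ZeroEntropy.

(** * The ergodic case *)

Section Ergodic.
Context {R : realType} {X : pointedMetricType R} (T : X -> X).
Context (mu : probability (borelType X) R).
Context (contT : continuous T).
Context (invmu : invariant_measure mu T).
Context (compactX : compact [set: X]).
Context (ergT : ergodic mu T).

(** Ergodicity is about sets equal to their preimage: the union of all the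
    preimages of [Z] is one, and it has the measure of [Z] since each preimage
    contains the previous one and has the same measure. *)
Lemma ergodic_forward_invariant (Z : set (borelType X)) : measurable Z ->
  Z `<=` T @^-1` Z -> pr mu Z = 0 \/ pr mu Z = 1.
Proof.
move=> mZ ZT; pose A : set (borelType X) := \bigcup_n (iter n T @^-1` Z).
have mT := measurable_preimage_borel contT.
have mTn n : measurable (iter n T @^-1` Z : set (borelType X)) by exact: (measurable_iter mT).
have mA : measurable A by exact: bigcup_measurable.
have invA : T @^-1` A = A.
  apply/seteqP; split => x [n _ Zn]; first by exists n.+1 => //=; rewrite -iterS iterSr.
  by exists n => //=; rewrite -iterSr; exact: ZT.
suff -> : pr mu Z = pr mu A by rewrite /pr; case: (ergT mA invA) => ->; [left|right].
apply/eqP; rewrite eq_le; apply/andP; split.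
  by apply: pr_le => // x Zx; exists 0%N.
apply/ler_addgt0Pr => e e0.
have [n x|n hn] := pr_approx_bigcup mu mA mTn _ (@subset_refl _ A) e0; first exact: ZT.
rewrite -(pr_iter mT invmu n mZ).
by apply: (le_trans (pr_le_addD mu mA (mTn n))); rewrite lerD2l.
Qed.

Lemma slow_le (e f a : R) : 0 < e -> e <= f -> slow T mu e a `<=` slow T mu f a.
Proof.
move=> e0 ef x h k _ m _; have [n mn hn] := h k I m I; exists n => //.
by apply: (lt_le_trans hn); exact: ball_pr_le.
Qed.

Theorem ergodic_entropy_gt0_restricted_sensitive :
  (0 < measure_entropy mu T)%E -> restricted_sensitive mu T.
Proof.
move=> /ereal_sup_gt[_ [k [P [partP ->]]]] hP.
pose e_ (j : nat) : R := j.+1%:R^-1.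
have e0 j : 0 < e_ j by rewrite invr_gt0.
pose Z : set (borelType X) := \bigcap_j slow T mu (e_ j) 0.
have mZ : measurable Z by apply: bigcap_measurable => // j _; exact: measurable_slow.
have ZT : Z `<=` T @^-1` Z by move=> x Zx j _; apply: slow_forward => //; exact: Zx.
case: (ergodic_forward_invariant mZ ZT) => pZ; last first.
  move: hP; rewrite (partition_entropy_zero contT invmu compactX partP) ?ltxx// => e egt.
  have [j je] := exists_natSinv_le egt.
  have mS := measurable_slow mu contT 0 egt.
  apply/eqP; rewrite eq_le pr_ge0 andbT prC// subr_le0 -pZ.
  by apply: pr_le => // x Zx; apply: (slow_le (e0 j) je); exact: Zx.
exists Z; split => //; first by apply: etrans (prE mu mZ) _; rewrite pZ.
move=> x nx j _; apply: contrapT => nslow; apply: nx.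
exact: (not_slow0_sensitive contT (e0 j) nslow).
Qed.

End Ergodic.

Theorem theoremA (R : realType) (X : pointedMetricType R) (T : X -> X)
    (mu : probability (borelType X) R)
    (compactX : compact [set: X]) (contT : continuous T)
    (invmu : invariant_measure mu T) :
  {ae mu, forall x : X, exists h : \bar R,
      is_local_entropy mu T x h /\ restricted_rate mu T x = (h^-1)%E} /\
  (ergodic mu T ->
    (restricted_sensitive mu T <-> (0 < measure_entropy mu T)%E)).
Proof.
split.
  apply: ae_imp (local_entropy_exists contT invmu compactX) => x hx.
  exists (lower_local_entropy mu T x); split; first by split.
  exact: restricted_rate_inv.
move=> ergT; split; first exact: restricted_sensitive_entropy_gt0.
exact: ergodic_entropy_gt0_restricted_sensitive.
Qed.
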